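(* Let $G$ be a traceable cubic graph. Then $G$ has a decomposition into a spanning tree, a matching and a family of cycles; that is, $E(G)$ can be partitioned as $E(G) = E(T) \sqcup M \sqcup \bigsqcup_{C \in \mathcal{C}} E(C)$, where $T$ is a spanning tree of $G$, $M$ is a matching of $G$, and $\mathcal{C}$ is a family of cycles of $G$.
   Context: Graphs are simple and undirected, with vertex set $V(G)$ and edge set $E(G)$. A graph is cubic if every vertex has degree $3$. A graph is traceable if it possesses a Hamiltonian path, i.e. a path $v_1, \dots, v_n$ that visits every vertex of $G$ exactly once. A decomposition of $G$ is a collection of pairwise edge-disjoint subgraphs whose edge sets together cover $E(G)$. The matching (a set of pairwise vertex-disjoint edges) is allowed to be empty. *)

(* Defs.v *)
From mathcomp Require Import all_boot.

Set Implicit Arguments.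
Unset Strict Implicit.
Unset Printing Implicit Defensive.

Record sgraph := SGraph {
  vertex :> finType;
  edge : rel vertex;
  edge_sym : symmetric edge;
  edge_irr : irreflexive edge }.

(* An edge is the two-element set of its ends. *)
Definition edges (G : sgraph) : {set {set G}} :=
  [set [set x; y] | x in G, y in G & edge x y].

Definition cubic (G : sgraph) : Prop :=
  forall x : G, #|[set y | edge x y]| = 3.

(* A path has at least one vertex, so a traceable graph is nonempty. *)
Definition traceable (G : sgraph) : Prop :=
  exists (x : G) (p : seq G),
    [/\ path (@edge G) x p, uniq (x :: p) & forall y : G, y \in x :: p].

(* C is the edge set of a cycle of G; the cycle is determined by it. *)
Definition is_cycle (G : sgraph) (C : {set {set G}}) : Prop :=
  exists c : seq G,
    [/\ 2 < size c, uniq c, cycle (@edge G) c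
      & C = [set [set x; next c x] | x in c]].
Arguments is_cycle : clear implicits.

Definition is_connected (G : sgraph) : Prop :=
  forall x y : G, connect (@edge G) x y.

Definition acyclic (G : sgraph) : Prop :=
  forall C : {set {set G}}, ~ is_cycle G C.

Definition is_tree (G : sgraph) : Prop := is_connected G /\ acyclic G.

Section SpanningSubgraph.
Variables (G : sgraph) (F : {set {set G}}).

Definition span_edge : rel G := [rel x y | (x != y) && ([set x; y] \in F)].

Fact span_edge_sym : symmetric span_edge.
Proof. by move=> x y; rewrite /span_edge /= eq_sym setUC. Qed.

Fact span_edge_irr : irreflexive span_edge.
Proof. by move=> x; rewrite /span_edge /= eqxx. Qed.

(* The graph with all the vertices of G and edge set F. *)
Definition span_graph : sgraph := SGraph span_edge_sym span_edge_irr.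

End SpanningSubgraph.

Definition is_spanning_tree (G : sgraph) (F : {set {set G}}) : Prop :=
  F \subset edges G /\ is_tree (span_graph F).

(* trivIset M: distinct edges in M share no vertex. *)
Definition is_matching (G : sgraph) (M : {set {set G}}) : Prop :=
  (M \subset edges G) && trivIset M.

Arguments is_spanning_tree : clear implicits.
Arguments is_matching : clear implicits.

(* Main.v *)
Require Import Defs.
From mathcomp Require Import all_boot zify.

(** Number the vertices along a Hamiltonian path from [0] to [N]. Besides its
    neighbour on the path, [0] has neighbours [i < j] and [N] has neighbours
    [k < l]. Let [W] be the path together with the edges [0j] and [Nk]. Every
    vertex has at least two edges of [W], so the edges outside [W] form a
    matching. Suppose that disjoint cycles are found such that
    - the graph without the edges of the cycles is connected, and
    - [W] without the edges of the cycles is acyclic.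
    Then what is left of [W] extends to a spanning tree that avoids the cycles,
    and the remaining edges lie outside [W], hence form a matching
    ([assemble], [decompose_cycles]). It remains to find the cycles, and [W]
    has at most three cycles to be broken.

    Cycles come from two sources. An innermost chord closes an interval of the
    path to a cycle; each inner vertex of the interval keeps an edge that leaves
    the interval, so it stays attached when the cycle is removed. Two disjoint
    intervals of this kind serve if no edge joins their interiors
    ([two_intervals]). On the other hand, any cycle can be rerouted, keeping
    one of its edges, until its complement is connected, unless some set of
    vertices is cut off by at most two edges ([grow]). If such a set avoids [j]
    and [k], it is an interval of the path that is closed under the edges outside
    [W] ([small_cut_closed]). It then contains an innermost chord, and no edge
    joins the interior of that chord's interval to vertices outside the set.

    If [0] and [N] are adjacent, one interval is enough. If [k < j], then [W]
    consists of three paths between the branch vertices [k] and [j]. A cycle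
    through [k] with connected complement breaks all cycles of [W]. Rerouting
    the three cycles of [W] yields such a cycle, or closed intervals in two of
    the three paths, and these give two intervals ([theta_decomposable]).

    If [j < k], then [W] has two cycles, one at each end of the path. Take the
    path with [(i, j)] lexicographically smallest. The third neighbour [w] of
    [i - 1] then satisfies [j < w], and running through the first [i] vertices
    backwards gives a second path, with [i - 1] first and [w] in place of [j];
    it falls under the cases above unless [w < k].
    Fix an innermost chord beyond [k]. Innermost chords between [0] and [i] on
    the first path, and between [i - 1] and [j] on the second, each finish the
    proof, unless edges [uv] and [cd] lead from these two intervals into the
    interval beyond [k]. In that case a cycle through [uv] and [cd] is rerouted,
    keeping [uv]. Either it ends with connected complement and breaks both
    cycles of [W], or there is a closed interval between [u] and [c], which gives
    two intervals again ([crossing_decomposable]). *)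
Set Implicit Arguments.
Unset Strict Implicit.
Unset Printing Implicit Defensive.

(** * Cycles as sequences, and acyclic relations *)

Section AcyclicRelations.

Variable T : eqType.
Implicit Types (r : rel T) (c s : seq T) (x y : T).

Lemma next_prev_neq c x :
  2 < size c -> uniq c -> x \in c -> next c x != prev c x.
Proof.
move=> c2 Uc xc; apply/eqP => E.
have: next c (next c x) = x by rewrite E next_prev.
case: (rot_to xc) => k s Ds; rewrite -!(next_rot k Uc) Ds.
have: uniq (x :: s) by rewrite -Ds rot_uniq.
have: 2 < size (x :: s) by rewrite -Ds size_rot.
case: s {Ds} => [|y [|z s]] //= _; rewrite eqxx !inE !negb_or.
move=> /andP[/and3P[/negPf xy xz _] _]; rewrite eq_sym xy eqxx => zx.
by rewrite zx eqxx in xz.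
Qed.

Lemma cycle_from_next r c :
  uniq c -> (forall x, x \in c -> r x (next c x)) -> cycle r c.
Proof.
move=> Uc rc.
apply: (sub_in_cycle (P := mem c) (e := frel (next c)) _ _ (cycle_next Uc)).
  by move=> x y xc _ /eqP<-; apply: rc.
by apply/allP.
Qed.

Definition acyclic_rel r := forall c, uniq c -> 2 < size c -> ~ cycle r c.

Lemma acyclic_rel_sub r r' :
  (forall x y, r x y -> r' x y) -> acyclic_rel r' -> acyclic_rel r.
Proof. by move=> rr' ar' c Uc c2 /(sub_cycle rr'); apply: ar'. Qed.

Definition add_edge r a b : rel T :=
  [rel x y | [|| r x y, (x == a) && (y == b) | (x == b) && (y == a)]].

(** A cycle through [ab] crosses the cut [A] at least twice, but [ab] is
    the only edge that crosses it. *)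
Lemma acyclic_rel_add r (A : pred T) a b :
  (forall x y, r x y -> A x = A y) -> A a != A b ->
  acyclic_rel r -> acyclic_rel (add_edge r a b).
Proof.
move=> closA AaDb ar c Uc c2 cyc_c.
have key (B : pred T) u v s : (forall x y, r x y -> B x = B y) ->
    B u -> ~~ B v -> uniq [:: u, v & s] -> s != [::] ->
    ~ cycle (add_edge r u v) [:: u, v & s].
  have Eb x y : add_edge r u v x y -> [\/ r x y, x = u | x = v /\ y = u].
    by case/or3P=> [?|/andP[/eqP-> _]|/andP[/eqP-> /eqP->]]; constructor.
  move: (add_edge r u v) Eb => e Eb closB Bu nBv /= /and3P[us vs _] s0.
  rewrite inE negb_or in us; case/andP: us => uv us.
  rewrite rcons_path => /and3P[_ ps].
  have nBl : ~~ B (last v s).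
    have: ~~ B v := nBv; move: us ps uv.
    elim: s {1 2 3 4}v {vs s0} => [//|y s' IH] w /=.
    rewrite inE negb_or => /andP[uy us] /andP[wy ps] uw nBw; apply: IH => //.
    case/Eb: wy => [/closB<- //|wu|[_ yu]]; first by rewrite wu eqxx in uw.
    by rewrite yu eqxx in uy.
  case/Eb=> [/closB E|E|[E _]].
  - by rewrite E Bu in nBl.
  - by rewrite E Bu in nBl.
  by case: (s) s0 vs E => [//|y s'] _ vs E; rewrite -E /= mem_last in vs.
have rot_c x y : x \in c -> next c x = y ->
    exists2 s, rot (index x c) c = [:: x, y & s] & s != [::].
  move=> xc <-; have := rot_index xc; set s := _ ++ _ => Ds.
  have: 2 < size (x :: s) by rewrite -Ds size_rot.
  rewrite -(next_rot (index x c) Uc) Ds.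
  by case: s {Ds} => [|y' [|z s]] //= _; rewrite eqxx; exists (z :: s).
have [c_r|] := boolP (cycle r c); first exact: ar c_r.
move=> not_r; have [x xc nrx] : exists2 x, x \in c & ~~ r x (next c x).
  apply/hasP; apply: contraNT not_r => /hasPn H.
  by apply: (cycle_from_next Uc) => x /H; rewrite negbK.
have swap u v : add_edge r u v =2 add_edge r v u.
  by move=> p q /=; congr (_ || _); rewrite orbC.
case/or3P: (next_cycle cyc_c xc) => [|/andP[/eqP xa /eqP xb]|/andP[/eqP xb /eqP xa]].
- by rewrite (negPf nrx).
- rewrite xa in xc xb; case: (rot_c a b xc xb) => s Ds s0.
  have Us : uniq [:: a, b & s] by rewrite -Ds rot_uniq.
  have cs : cycle (add_edge r a b) [:: a, b & s] by rewrite -Ds rot_cycle.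
  case Aa: (A a) AaDb; case Ab: (A b) => // _.
    by apply: (key A a b s closA Aa) cs; rewrite ?Ab.
  apply: (key (predC A) a b s _ _ _ Us s0 cs);
      by [move=> p q /closA /= ->|rewrite /= ?Aa ?Ab|rewrite /= ?Aa ?Ab].
rewrite xb in xc xa; case: (rot_c b a xc xa) => s Ds s0.
have Us : uniq [:: b, a & s] by rewrite -Ds rot_uniq.
have cs : cycle (add_edge r b a) [:: b, a & s].
  by rewrite -(eq_cycle (swap a b)) -Ds rot_cycle.
case Aa: (A a) AaDb; case Ab: (A b) => // _.
  apply: (key (predC A) b a s _ _ _ Us s0 cs);
      by [move=> p q /closA /= ->|rewrite /= ?Aa ?Ab|rewrite /= ?Aa ?Ab].
by apply: (key A b a s closA) cs => //; rewrite ?Aa ?Ab.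
Qed.

End AcyclicRelations.

(** Two vertices next to the largest number of a cycle would both have to be
    its predecessor. *)
Lemma acyclic_succ : acyclic_rel [rel s t : nat | (t == s.+1) || (s == t.+1)].
Proof.
move=> c Uc c2 cyc_c.
case: c Uc c2 cyc_c => // x0 c Uc c2 cyc_c; set d := x0 :: c in Uc c2 cyc_c *.
have [m md max_m] : exists2 m, m \in d & forall t, t \in d -> t <= m.
  have ne : exists t, t \in d by exists x0; rewrite mem_head.
  have ub t : t \in d -> t <= \max_(u <- d) u.
    by move=> td; rewrite (big_rem t td) leq_maxl.
  by case: (ex_maxnP ne ub) => m md max_m; exists m.
have := next_prev_neq c2 Uc md.
have := next_cycle cyc_c md; have := prev_cycle cyc_c md.
have := max_m (next d m); have := max_m (prev d m).
rewrite mem_next mem_prev md; move: (next d m) (prev d m) => s t.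
by move=> /(_ isT) h1 /(_ isT) h2 /=; lia.
Qed.

(** * Reduction to a connected complement of cycles *)

Definition decomposable (G : sgraph) : Prop :=
  exists (F M : {set {set G}}) (CC : {set {set {set G}}}),
    [/\ is_spanning_tree G F, is_matching G M
      & forall C : {set {set G}}, C \in CC -> is_cycle G C] /\
    [/\ edges G = F :|: M :|: cover CC,
        [disjoint F & M], [disjoint F & cover CC], [disjoint M & cover CC]
      & trivIset CC].

Section EdgeSets.

Variable G : sgraph.
Implicit Types (x y : G) (D F H : {set {set G}}) (c : seq G).

Lemma eq_set2 x y a b : [set x; y] = [set a; b] :> {set G} ->
  x = a /\ y = b \/ x = b /\ y = a.
Proof.
move=> E; have := set21 x y; have := set22 x y; rewrite E !inE.
have := set21 a b; have := set22 a b; rewrite -E !inE.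
do 4![case/orP=> /eqP ?]; subst; auto.
Qed.

Lemma mem_edges x y : ([set x; y] \in edges G) = edge x y.
Proof.
apply/imset2P/idP => [[a b _]|xy].
  rewrite inE => /andP[_ ab] /eq_set2[[-> ->]|[-> ->]] //.
  by rewrite edge_sym.
by exists x y; rewrite ?inE.
Qed.

Lemma edges_ex (e : {set G}) :
  e \in edges G -> exists x y, edge x y /\ e = [set x; y].
Proof. by case/imset2P => x y _; rewrite inE => /andP[_ xy] ->; exists x, y. Qed.

Definition cedges c : {set {set G}} := [set [set x; next c x] | x in c].

Lemma mem_cedges c x y : [set x; y] \in cedges c ->
  x \in c /\ next c x = y \/ y \in c /\ next c y = x.
Proof.
by case/imsetP=> z zc /eq_set2[[-> ->]|[-> ->]]; [left|right].
Qed.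

Lemma cedges_ends c x y :
  [set x; y] \in cedges c -> x \in c /\ y \in c.
Proof. by case/mem_cedges=> [] [? <-]; rewrite mem_next. Qed.

Lemma next_cedges c x : x \in c -> [set x; next c x] \in cedges c.
Proof. by move=> xc; apply/imsetP; exists x. Qed.

Lemma prev_cedges c x : uniq c -> x \in c -> [set x; prev c x] \in cedges c.
Proof.
move=> Uc xc; apply/imsetP; exists (prev c x); first by rewrite mem_prev.
by rewrite next_prev // setUC.
Qed.

Definition off D : rel G := [rel x y | edge x y && ([set x; y] \notin D)].

Lemma off_sym D : symmetric (off D).
Proof. by move=> x y; rewrite /off /= edge_sym setUC. Qed.

Lemma connect_off_sym D : connect_sym (off D).
Proof. exact/sym_connect_sym/off_sym. Qed.

(** Joining two components never closes a cycle, so edges can be added until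
    every edge of [H] has its ends in one component. *)
Lemma extend_forest F H :
  F \subset H -> acyclic_rel (span_edge F) ->
  exists F', [/\ F \subset F', F' \subset H, acyclic_rel (span_edge F')
    & forall x y, [set x; y] \in H -> connect (span_edge F') x y].
Proof.
have [m] := ubnP #|H :\: F|; elim: m F => // m IH F ltm FH aF.
have [/existsP[x /existsP[y /andP[xyH nxy]]]|noxy] :=
  boolP [exists x, exists y, ([set x; y] \in H) && ~~ connect (span_edge F) x y].
  have symF : connect_sym (span_edge F).
    exact/sym_connect_sym/span_edge_sym.
  have nxyF : [set x; y] \notin F.
    apply: contra nxy => xyF; have [->|xy] := eqVneq x y; first exact: connect0.
    by apply: connect1; rewrite /span_edge /= xy.
  have [] := IH ([set x; y] |: F).
  - rewrite ltnS in ltm; apply: leq_trans ltm; apply: proper_card.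
    rewrite properE; apply/andP; split.
      by apply: setDS; apply: subsetUr.
    apply/subsetPn; exists [set x; y]; first by rewrite in_setD nxyF.
    by rewrite in_setD in_setU1 eqxx.
  - by rewrite subUset sub1set xyH FH.
  - apply: (@acyclic_rel_sub _ _ (add_edge (span_edge F) x y)).
      move=> u v; rewrite /add_edge /span_edge /= in_setU1.
      case/andP=> uv /orP[/eqP/eq_set2[[-> ->]|[-> ->]]|uvF].
      - by rewrite !eqxx !orbT.
      - by rewrite !eqxx !orbT.
      by rewrite uv uvF.
    apply: (@acyclic_rel_add _ _ (connect (span_edge F) x)) => //.
      by move=> u v /connect1 uv; apply: (same_connect_r symF).
    by rewrite connect0 (negPf nxy).
  move=> F' [sF' ? ? ?]; exists F'; split=> //.
  by apply: subset_trans sF'; apply: subsetUr.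
exists F; split=> // x y xyH.
move/existsPn/(_ x)/existsPn/(_ y): noxy.
by rewrite xyH negbK.
Qed.

(** Any edges outside the cycles may be added to the tree, because what stays
    outside it is still part of a matching. *)
Lemma assemble (CC : {set {set {set G}}}) F :
  (forall C, C \in CC -> is_cycle G C) -> trivIset CC ->
  F \subset edges G :\: cover CC -> acyclic_rel (span_edge F) ->
  (forall x y, connect (off (cover CC)) x y) ->
  trivIset (edges G :\: cover CC :\: F) -> decomposable G.
Proof.
move=> cycCC triv FH aF conn tM; set H := edges G :\: cover CC in FH tM.
have CCe : cover CC \subset edges G.
  apply/bigcupsP => C /cycCC [c [_ _ cyc_c ->]].
  apply/subsetP => _ /imsetP[x xc ->].
  by rewrite mem_edges; apply: next_cycle.
have [T [FT TH aT cT]] := extend_forest FH aF.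
exists T, (H :\: T), CC; split; split=> //.
- split; first by apply: subset_trans TH _; apply: subsetDl.
  split=> [x y|C [c [c2 Uc cyc_c _]]]; last exact: aT cyc_c.
  apply: connect_sub (conn x y) => u v /andP[uv nuv].
  by apply: cT; rewrite inE nuv mem_edges.
- apply/andP; split.
    by apply: subset_trans (subsetDl _ _) _; apply: subsetDl.
  by apply: trivIsetS tM; apply: setDS.
- rewrite -setUA; apply/setP => e; rewrite !inE.
  have := subsetP CCe e; have := subsetP TH e; rewrite /H !inE.
  case: (e \in T) => [/(_ isT)/andP[_ ->] //|_].
  by case: (e \in cover CC) => [/(_ isT)->|_]; rewrite ?orbT //= ?orbF.
- by rewrite disjoint_sym disjoints_subset; apply/subsetP=> e; rewrite !inE => /andP[].
- rewrite disjoints_subset; apply: subset_trans TH _; rewrite /H.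
  by apply/subsetP=> e; rewrite !inE => /andP[].
rewrite disjoints_subset; apply/subsetP=> e.
by rewrite /H !inE => /and3P[].
Qed.

End EdgeSets.

(** * Rerouting a cycle to enlarge a component of its complement *)

Section Growth.

Variable G : sgraph.
Hypothesis G3 : cubic G.
Implicit Types (x y u v : G) (c p q : seq G).

Lemma cubic_nbr x a b d e :
  edge x a -> edge x b -> edge x d -> uniq [:: a; b; d] -> edge x e ->
  e \in [:: a; b; d].
Proof.
move=> xa xb xd U xe; have := G3 x; set N := [set y | _] => cardN.
have sub : [set z in [:: a; b; d]] \subset N.
  by apply/subsetP=> z; rewrite !inE => /or3P[] /eqP->.
have: [set z in [:: a; b; d]] == N.
  by rewrite eqEcard sub cardN cardsE (card_uniqP U).
by move/eqP/setP/(_ e); rewrite !inE xe.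
Qed.

Lemma cubic_third x a b : edge x a -> edge x b -> a != b ->
  exists d, [/\ edge x d, d != a & d != b].
Proof.
move=> xa xb ab; have /set0Pn[d] : [set y | edge x y] :\: [set a; b] != set0.
  rewrite -card_gt0 cardsD G3 subn_gt0.
  have := subset_leq_card (subsetIr [set y | edge x y] [set a; b]).
  by rewrite cards2 ab.
by rewrite !inE negb_or => /andP[/andP[da db] xd]; exists d.
Qed.

(** Two of the three neighbours of a vertex on the cycle follow and precede it
    there. *)
Lemma off_unique c x u v : uniq c -> cycle (@edge G) c -> 2 < size c ->
  x \in c -> off (cedges c) x u -> off (cedges c) x v -> u = v.
Proof.
move=> Uc cyc_c c2 xc /andP[xu nu] /andP[xv nv].
have xn : edge x (next c x) by apply: next_cycle.
have xp : edge x (prev c x) by rewrite edge_sym; apply: prev_cycle.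
have un : u != next c x by apply: contraNneq nu => ->; apply: next_cedges.
have up : u != prev c x by apply: contraNneq nu => ->; apply: prev_cedges.
have vn : v != next c x by apply: contraNneq nv => ->; apply: next_cedges.
have vp : v != prev c x by apply: contraNneq nv => ->; apply: prev_cedges.
have: v \in [:: next c x; prev c x; u].
  apply: cubic_nbr xv => //; rewrite /= !inE negb_or (eq_sym _ u) un (eq_sym _ u).
  by rewrite up next_prev_neq.
by rewrite !inE (negPf vn) (negPf vp) => /eqP.
Qed.

(** A vertex of the cycle has one neighbour off it, so a path off the cycle
    can only meet the cycle at its ends. *)
Lemma off_path_meets c x p u : uniq c -> cycle (@edge G) c -> 2 < size c ->
  path (off (cedges c)) x p -> uniq (x :: p) -> u \in p -> u \in c ->
  u = last x p.
Proof.
move=> Uc cyc_c c2 pp Up up uc; case/splitPr: up pp Up => p1 p2.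
rewrite last_cat cat_path -cat_cons cat_uniq.
case: p2 => [//|v p2] /= /and4P[_ wu uv _] /and3P[_ /norP[_ nv] _].
have wv : last x p1 = v.
  by apply: (off_unique Uc cyc_c c2 uc) uv; rewrite off_sym.
by move: nv; rewrite /= negb_or -wv mem_last.
Qed.

Lemma path_all (P : pred G) x p :
  all P (x :: p) -> path (fun u v => P u && P v) x p.
Proof. by elim: p x => //= y p IH x /and3P[-> Py Pp]; rewrite Py IH //= Py. Qed.

Variables (S : {set G}) (a b : G).

(** The closing edge [ba] of the cycle [a :: q] is kept while the rest of the
    cycle is rerouted, and [S] stays in the component of [a]. *)
Definition good_cycle q :=
  [/\ uniq (a :: q), cycle (@edge G) (a :: q), 2 < size (a :: q), last a q = b
    & forall s, s \in S -> connect (off (cedges (a :: q))) a s].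

Definition comp q : pred G := connect (off (cedges (a :: q))) a.

Lemma cycle_replace (e : rel G) s1 mid p y s2 :
  cycle e (a :: s1 ++ mid ++ y :: s2) -> path e (last a s1) (rcons p y) ->
  cycle e (a :: s1 ++ p ++ y :: s2).
Proof.
rewrite /= !rcons_cat /= !cat_path /= !rcons_path.
by case/and5P=> -> _ _ -> -> /andP[-> ->].
Qed.

(** Replacing the part [mid] of the cycle by a path outside the component of
    [a] enlarges that component: [z] leaves the cycle, so its edges are now
    available, and one of them leads to a new vertex. *)
Lemma reroute s1 mid y s2 z t (q := s1 ++ mid ++ y :: s2) :
  good_cycle q -> ~~ comp q (last a s1) -> last a s1 != y ->
  z \in mid -> comp q z -> edge z t -> ~~ comp q t ->
  connect (off (cedges (a :: q))) (last a s1) y ->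
  exists q', good_cycle q' /\ #|predC (comp q')| < #|predC (comp q)|.
Proof.
move=> [Uc cyc_c c2 lastq Sq] nKr ry zmid Kz zt nKt.
set r := last a s1 in nKr ry *; set O := off _.
have Osym : connect_sym O by apply: connect_off_sym.
case/connectP=> p0 /shortenP[p pp Up _] yp {p0}.
have nKp u : u \in r :: p -> ~~ comp q u.
  move=> up; apply: contra nKr => /connect_trans; apply.
  rewrite Osym; case/splitPl: up pp => p1 p2 <-; rewrite cat_path => /andP[pp _].
  by apply/connectP; exists p1.
case/lastP: p => [|p y'] in yp pp Up nKp *; first by rewrite /= in yp; rewrite yp eqxx in ry.
rewrite last_rcons in yp; subst y'.
have p_off u : u \in p -> u \notin a :: q.
  move=> up; apply/negP => uc.
  have := off_path_meets Uc cyc_c c2 pp Up; rewrite last_rcons => /(_ u).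
  rewrite mem_rcons inE up orbT uc => /(_ isT isT) uy.
  by move: Up; rewrite -uy /= rcons_uniq up andbF.
have p_ends : path (fun u v => ~~ comp q u && ~~ comp q v) r (rcons p y).
  by apply: (@path_all (predC (comp q))); apply/allP => u /nKp.
set q' := s1 ++ p ++ y :: s2.
have Uc' : uniq (a :: q').
  have Upp : uniq p by move: Up; rewrite /= rcons_uniq => /and3P[].
  have memq u : u \in a :: q = (u \in a :: s1) || (u \in mid) || (u \in y :: s2).
    by rewrite /q -cat_cons !mem_cat orbA.
  have [U1 U2 U3] : [/\ uniq (a :: s1), uniq (y :: s2)
      & ~~ has (mem (a :: s1)) (y :: s2)].
    move: Uc; rewrite /q -cat_cons 2!cat_uniq has_cat negb_or.
    by case/and3P=> -> /andP[_ ->] /and3P[_ _ ->].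
  rewrite /q' -cat_cons cat_uniq U1 has_cat negb_or U3 cat_uniq Upp U2 !andbT !andTb.
  apply/andP; split; apply/hasPn => u.
    by move/p_off; rewrite memq !negb_or => /andP[/andP[]].
  by move=> us; apply: contraL us => /p_off; rewrite memq negb_or => /andP[].
have cyc_c' : cycle (@edge G) (a :: q').
  apply: cycle_replace cyc_c _; apply: sub_path pp.
  by move=> u v /andP[].
have c'2 : 2 < size (a :: q').
  have: 0 < size s1.
    case: (posnP (size s1)) => // /size0nil E; case/negP: nKr.
    by rewrite /r E; apply: connect0.
  by rewrite /q' /= !size_cat /= !addnS; case: (size s1).
have new_edges u v : [set u; v] \in cedges (a :: q') ->
    [set u; v] \in cedges (a :: q) \/ (~~ comp q u /\ ~~ comp q v).
  pose e u v := ([set u; v] \in cedges (a :: q)) || (~~ comp q u && ~~ comp q v).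
  have ce : cycle e (a :: q').
    apply: (@cycle_replace _ _ mid).
      by apply: cycle_from_next => // x xc; rewrite /e next_cedges.
    by apply: sub_path p_ends => x x' xx'; rewrite /e xx' orbT.
  case/mem_cedges=> [] [uc <-]; case/orP: (next_cycle ce uc) => [ec|/andP[n1 n2]].
  - by left.
  - by right.
  - by left; rewrite setUC.
  by right.
have subK u : comp q u -> comp q' u.
  case/connectP=> p1 pp1 ->.
  elim/last_ind: p1 pp1 => [|p1 x IH]; first by move=> _; apply: connect0.
  rewrite rcons_path last_rcons => /andP[pp1 ex].
  apply: connect_trans (IH pp1) (connect1 _).
  have Kl : comp q (last a p1) by apply/connectP; exists p1.
  move: ex; rewrite /off /= => /andP[-> nex] /=.
  by apply: contra nex => /new_edges[//|[]]; rewrite Kl.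
have z_off : z \notin a :: q'.
  have zc : z \in a :: q by rewrite /q -cat_cons !mem_cat zmid orbT.
  have zp : z \notin p by apply: contraL zc => /p_off.
  move: Uc; rewrite /q /q' -!cat_cons 2!cat_uniq has_cat negb_or.
  case/and3P=> _ /andP[/hasPn/(_ z zmid) z1 _] /and3P[_ /hasPn z2 _].
  rewrite !mem_cat; apply/norP; split=> //; apply/norP; split=> //.
  by apply: contraL zmid => /z2.
exists q'; split.
  split=> //; last by move=> s /Sq/subK.
  by rewrite -lastq /q' /q !last_cat.
apply: proper_card; apply/properP; split.
  by apply/subsetP=> u; rewrite !inE; apply: contra; apply: subK.
exists t; rewrite !inE // negbK.
apply: connect_trans (subK z Kz) (connect1 _).
by rewrite /off /= zt; apply: contra z_off => /cedges_ends[].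
Qed.

Definition small_cut (X : {set G}) (f g : {set G}) :=
  forall x y, x \in X -> y \notin X -> edge x y ->
    [set x; y] = f \/ [set x; y] = g.

Lemma first_run (K : pred G) q : has (predC K) q ->
  exists q1 x run rest, [/\ q = q1 ++ (x :: run) ++ rest, all K q1,
    all (predC K) (x :: run)
    & rest = [::] \/ exists z rest', rest = z :: rest' /\ K z].
Proof.
case/split_find=> x q1 q2 nKx; rewrite has_predC negbK => q1K.
exists q1, x; have [hasK|] := boolP (has K q2).
  case/split_find: hasK => z run rest Kz; rewrite -all_predC => runL.
  exists run, (z :: rest); split=> //; last by right; exists z, rest.
  - by rewrite !cat_rcons.
  - by rewrite /= runL andbT.
rewrite -all_predC => q2L; exists q2, [::]; split=> //; last by left.
- by rewrite cats0 cat_rcons.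
- by rewrite /= q2L andbT.
Qed.

(** Take a cycle whose component [K] of [a] is largest. The vertices of the
    cycle outside [K] form runs. Two runs lying in one component could be
    joined by rerouting the cycle, and the vertices of [K] between them would
    leave the cycle. So the components that meet the first run meet no other,
    and only the two end edges of the run leave their union. *)
Lemma grow q : good_cycle q ->
  (exists q', good_cycle q' /\ forall u, comp q' u) \/
  (exists X f g, [/\ X != set0, [disjoint S & X], a \notin X
     & small_cut X f g]).
Proof.
have [m] := ubnP #|predC (comp q)|; elim: m q => // m IH q ltm Gq.
have [/pred0P K0|] := boolP (pred0b (predC (comp q))).
  by left; exists q; split=> // u; have /negbFE := K0 u.
case/pred0Pn=> v0 nKv0.
have [Uc cyc_c c2 lastq Sq] := Gq.
set c := a :: q in Uc cyc_c c2 Sq.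
have Osym : connect_sym (off (cedges c)) by apply: connect_off_sym.
have Ka : comp q a by apply: connect0.
have [qK|] := boolP (all (comp q) q).
  right; exists [set u | ~~ comp q u], set0, set0; split.
  - by apply/set0Pn; exists v0; rewrite inE.
  - rewrite disjoints_subset; apply/subsetP=> s sS.
    by rewrite !inE negbK; apply: Sq.
  - by rewrite inE negbK.
  move=> x y; rewrite !inE negbK => nKx Ky xy; exfalso.
  have xc : [set x; y] \in cedges c.
    apply: contraR nKx => nxy; apply: connect_trans Ky (connect1 _).
    by rewrite off_sym /off /= xy.
  case/cedges_ends: xc => xc _; move: nKx.
  by move: xc; rewrite inE => /predU1P[->|/(allP qK)->]; rewrite ?Ka.
rewrite -has_predC => /first_run[q1 [x [run [rest [Dq q1K runL restK]]]]].
set R := x :: run in Dq runL.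
have Rc u : u \in R -> u \in c by rewrite /c Dq !(mem_cat, inE) => ->; rewrite !orbT.
pose X := [set v | has (fun u => connect (off (cedges c)) u v) R].
have RX u : u \in R -> u \in X.
  by move=> uR; rewrite inE; apply/hasP; exists u => //; apply: connect0.
have XL u : u \in X -> ~~ comp q u.
  rewrite inE => /hasP[v /(allP runL) /= nKv vu]; apply: contra nKv => Ku.
  by apply: connect_trans Ku _; rewrite Osym.
have [/hasP[y y_rest yX]|restX] := boolP (has (mem X) rest).
  have {restK} [z [rest' [Drest Kz]]] : exists z rest', rest = z :: rest' /\ comp q z.
    by case: restK y_rest => [->|//].
  have /hasP[r rR ry] : has (fun u => connect (off (cedges c)) u y) R.
    by have := yX; rewrite /= inE.
  have {}y_rest : y \in rest'.
    by move: y_rest (XL y yX); rewrite Drest inE => /predU1P[->|//]; rewrite Kz.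
  case/splitPr: y_rest Drest => m1 m2 Drest.
  have [r1 [r2 DR]] : exists r1 r2, R = r1 ++ r :: r2.
    by case/splitPr: rR => r1 r2; exists r1, r2.
  pose s1 := q1 ++ rcons r1 r; pose mid := r2 ++ z :: m1.
  have Dq' : q = s1 ++ mid ++ y :: m2.
    by rewrite Dq DR Drest /s1 /mid -!catA cat_rcons.
  have lasts1 : last a s1 = r by rewrite /s1 last_cat last_rcons.
  have := @reroute s1 mid y m2 z (last r r2); rewrite -Dq' lasts1.
  case=> //.
  - by apply: (allP runL).
  - move: Uc; rewrite /c Dq' -cat_cons catA cat_uniq => /and3P[_ /hasPn/(_ y)].
    rewrite mem_head => /(_ isT) yn _; apply: contra yn => /eqP<-.
    by rewrite /s1 !(mem_cat, inE, mem_rcons) eqxx !orbT.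
  - by rewrite /mid mem_cat mem_head orbT.
  - rewrite edge_sym; move: cyc_c; rewrite /c Dq' /= rcons_path cat_path lasts1.
    by case/andP=> /andP[_]; rewrite /mid -catA cat_path => /and3P[].
  - apply: (allP runL); rewrite DR mem_cat.
    by rewrite mem_last orbT.
  move=> q' [Gq' ltq']; have [] := IH q' _ Gq'; first exact: leq_trans ltq' _.
    by left.
  by right.
right; exists X, [set last a q1; x], [set last x run; head a rest]; split.
- by apply/set0Pn; exists x; apply: RX; apply: mem_head.
- rewrite disjoint_sym disjoints_subset; apply/subsetP=> u /XL.
  by rewrite inE; apply: contra => /Sq.
- by apply: contraL Ka => /XL.
have aR : a \notin R by apply: contraL Ka => /RX/XL.
pose e u v := [|| (u \in R) && (v \in R), [set u; v] == [set last a q1; x],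
  [set u; v] == [set last x run; head a rest] | (u \notin R) && (v \notin R)].
have ce : cycle e c.
  rewrite /c Dq /= rcons_cat cat_path /= -/R.
  have out p v : all (fun w => w \notin R) (v :: p) -> path e v p.
    move=> /path_all; apply: sub_path => u w uw.
    by rewrite /e uw !orbT.
  apply/and3P; split.
  - apply: out; rewrite /= aR; apply/allP => u /(allP q1K).
    by apply: contraL => /RX/XL.
  - by rewrite /e eqxx !orbT.
  rewrite rcons_cat cat_path; apply/andP; split.
    apply: sub_path (path_all (P := mem R) (x := x) (p := run) _).
      by move=> u w /= uw; rewrite /e uw.
    by apply/allP.
  have eg v : head a rest = v -> e (last x run) v.
    by move=> <-; rewrite /e eqxx !orbT.
  case: restK => [Dr|[z [rest' [Dr Kz]]]]; rewrite [in rcons _ _]Dr /=.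
    by rewrite eg ?Dr.
  rewrite eg ?Dr //=; apply: out; rewrite -rcons_cons all_rcons aR.
  have rX v : v \in rest -> v \notin R.
    by move=> /(hasPn restX); apply: contra => /RX.
  by apply/allP => v; rewrite -Dr => /rX.
have XR u : u \in c -> u \in X -> u \in R.
  rewrite /c Dq inE !mem_cat => /or4P[/eqP->||//|].
  - by move/XL; rewrite Ka.
  - by move/(allP q1K) => Ku /XL; rewrite Ku.
  by move/(hasPn restX)/negP.
move=> u v uX nvX uv.
have uvc : [set u; v] \in cedges c.
  apply: contraR nvX => nuv; move: uX; rewrite !inE => /hasP[w wR wu].
  apply/hasP; exists w => //; apply: connect_trans wu (connect1 _).
  by rewrite /off /= uv.
have uR : u \in R by apply: XR uX; case/cedges_ends: uvc.
have nvR : v \notin R by apply: contra nvX => /RX.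
case/mem_cedges: uvc => [] [wc Dw]; have := next_cycle ce wc; rewrite Dw /e.
  by rewrite uR (negPf nvR) /= => /or3P[/eqP|/eqP|//]; auto.
by rewrite uR (negPf nvR) /= setUC => /or3P[/eqP|/eqP|//]; auto.
Qed.

End Growth.

(** * Numbering the vertices along a Hamiltonian path *)

Definition ham_order (G : sgraph) (N : nat) (at_ : nat -> G) :=
  [/\ forall v, exists2 t, t <= N & at_ t = v,
      forall s t, s <= N -> t <= N -> at_ s = at_ t -> s = t
    & forall t, t < N -> edge (at_ t) (at_ t.+1)].

Section Numbered.

Variables (G : sgraph) (N : nat) (at_ : nat -> G).
Hypothesis G3 : cubic G.
Hypothesis ham : ham_order N at_.

Definition adj_at : rel nat := [rel s t | edge (at_ s) (at_ t)].

Local Notation adj := adj_at.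

Definition pos (v : G) : nat := index v (mkseq at_ N.+1).

Lemma pos_le v : pos v <= N.
Proof.
case: ham => surj _ _; have [t tN <-] := surj v.
rewrite -ltnS -[X in _ < X](size_mkseq at_) index_mem.
by apply/mapP; exists t => //; rewrite mem_iota.
Qed.

Lemma posK v : at_ (pos v) = v.
Proof.
rewrite -[RHS](nth_index v (s := mkseq at_ N.+1)).
  by rewrite nth_mkseq // ltnS pos_le.
by rewrite -index_mem size_mkseq ltnS pos_le.
Qed.

Lemma at_inj s t : s <= N -> t <= N -> at_ s = at_ t -> s = t.
Proof. by case: ham => _ inj _; apply: inj. Qed.

Lemma at_neq s t : s <= N -> t <= N -> s != t -> at_ s != at_ t.
Proof. by move=> sN tN; apply: contraNneq => /at_inj->. Qed.

Lemma atK t : t <= N -> pos (at_ t) = t.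
Proof. by move=> tN; apply: at_inj => //; rewrite ?pos_le ?posK. Qed.

Lemma adjS t : t < N -> adj t t.+1.
Proof. by case: ham => _ _; apply. Qed.

Lemma adj_sym : symmetric adj.
Proof. by move=> s t; rewrite /adj_at /= edge_sym. Qed.

Lemma adjP t : 0 < t -> t <= N -> adj t t.-1.
Proof. by case: t => // t _ tN; rewrite adj_sym adjS. Qed.

Lemma adj_irr t : adj t t = false.
Proof. by rewrite /adj_at /= edge_irr. Qed.

Lemma adj_nbr s a b d e :
  adj s a -> adj s b -> adj s d -> adj s e ->
  a <= N -> b <= N -> d <= N -> e <= N -> uniq [:: a; b; d] ->
  e \in [:: a; b; d].
Proof.
move=> sa sb sd se aN bN dN eN U.
have : at_ e \in [seq at_ t | t <- [:: a; b; d]].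
  apply: (cubic_nbr G3 sa sb sd _ se).
  rewrite -[X in uniq X]/[seq at_ t | t <- [:: a; b; d]] map_inj_in_uniq // => p q.
  rewrite !inE => pp qq; apply: at_inj;
    by [case/or3P: pp => /eqP->|case/or3P: qq => /eqP->].
case/mapP=> t tl /at_inj -> //; move: tl; rewrite !inE.
by case/or3P=> /eqP->.
Qed.

Lemma adj_third s a b : adj s a -> adj s b -> a <= N -> b <= N -> a != b ->
  exists t, [/\ t <= N, adj s t, t != a & t != b].
Proof.
move=> sa sb aN bN ab; have [d [sd da db]] := cubic_third G3 sa sb (at_neq aN bN ab).
by exists (pos d); rewrite pos_le /adj_at /= posK sd; split=> //;
  [apply: contraNneq da => <-|apply: contraNneq db => <-]; rewrite posK.
Qed.

Variables j k : nat.
Hypotheses (j1 : 1 < j) (jN : j <= N) (kN : k.+1 < N).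
Hypotheses (adj0j : adj 0 j) (adjNk : adj N k).

(** The path together with one more edge at each of its ends: every vertex
    keeps at most one other edge. *)
Definition walk : rel nat := [rel s t |
  [|| t == s.+1, s == t.+1, (s == 0) && (t == j), (s == j) && (t == 0),
      (s == N) && (t == k) | (s == k) && (t == N)]].

Lemma walk_sym : symmetric walk.
Proof. by move=> s t; rewrite /walk /=; do ![case: eqP => _ //=]. Qed.

Lemma walk_nbrs s : s <= N -> exists a b,
  [/\ a <= N, b <= N, a != b, walk s a /\ adj s a & walk s b /\ adj s b].
Proof.
move=> sN; have [->|s0] := posnP s.
  exists 1, j; split; first lia; first by []; first lia.
    by rewrite adjS; [split|lia].
  by rewrite adj0j /walk /= !eqxx !orbT.
have [->|sN'] := eqVneq s N.
  exists N.-1, k; split; first lia; first lia; first lia.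
    by rewrite adjP /walk /=; try lia; split=> //; lia.
  by rewrite adjNk /walk /= !eqxx !orbT.
exists s.-1, s.+1; split; first lia; first lia; first lia.
  by rewrite adjP // /walk /=; split=> //; lia.
by rewrite adjS /walk /=; [split=> //; lia|lia].
Qed.

Lemma chord_ex s : s <= N -> s != j -> s != k ->
  exists t, [/\ t <= N, adj s t & ~~ walk s t].
Proof.
move=> sN sj sk.
have [a [b [aN bN ab [wa sa] [wb sb]]]] := walk_nbrs sN.
have [t [tN st ta tb]] := adj_third sa sb aN bN ab.
by exists t; split=> //; move: wa wb; rewrite /walk /=; lia.
Qed.

(** The form in which the cycles are used: [r] is any acyclic relation that
    contains what the cycles leave of the walk. *)
Lemma decompose_cycles (CC : {set {set {set G}}}) (r : rel nat) :
  (forall C, C \in CC -> is_cycle G C) -> trivIset CC ->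
  (forall x y, connect (off (cover CC)) x y) ->
  (forall s t, s <= N -> t <= N -> walk s t ->
    [set at_ s; at_ t] \notin cover CC -> r s t) ->
  acyclic_rel r -> decomposable G.
Proof.
move=> cycCC triv conn sub_r ar.
pose F := [set e in edges G :\: cover CC |
  [exists x, exists y, (e == [set x; y]) && walk (pos x) (pos y)]].
have memF x y : [set x; y] \in F =
    [&& edge x y, [set x; y] \notin cover CC & walk (pos x) (pos y)].
  rewrite !inE mem_edges; case: (edge x y); case: (_ \in cover CC) => //=.
  apply/existsP/idP => [[u /existsP[v /andP[/eqP/eq_set2 E]]]|wxy].
    by case: E => [] [-> ->] //; rewrite walk_sym.
  by exists x; apply/existsP; exists y; rewrite eqxx.
apply: (@assemble G CC F) => //.
- by apply/subsetP=> e; rewrite inE => /andP[].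
- move=> c Uc c2 cyc_c; apply: (ar (map pos c)).
  + rewrite map_inj_uniq // => x y E.
    by rewrite -(posK x) E posK.
  + by rewrite size_map.
  rewrite cycle_map; apply: sub_cycle cyc_c => x y.
  rewrite /span_edge /= memF => /and4P[_ _ nxy wxy].
  by apply: sub_r; rewrite ?pos_le ?posK.
apply/trivIsetP => e1 e2; rewrite !inE => /and3P[n1 d1 ed1] /and3P[n2 d2 ed2] ne.
have star e v : e \in edges G -> v \in e -> exists2 u, edge v u & e = [set v; u].
  case/edges_ex => x [y [xy ->]]; rewrite !inE => /orP[] /eqP->; first by exists y.
  by exists x; rewrite ?(setUC [set x]) // edge_sym.
rewrite disjoint_subset; apply/subsetP=> v ve1; apply/negP => ve2.
have [u vu De1] := star e1 v ed1 ve1; have [u' vu' De2] := star e2 v ed2 ve2.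
have nw x e : e = [set v; x] -> e \in edges G -> e \notin cover CC -> 
    ~~ ([&& (e \notin cover CC) && (e \in edges G) & 
     [exists x, exists y, (e == [set x; y]) && walk (pos x) (pos y)]]) -> ~~ walk (pos v) (pos x).
  move=> De -> -> /=; apply: contra => wvx; apply/existsP; exists v.
  by apply/existsP; exists x; rewrite De eqxx.
have wu := nw u e1 De1 ed1 d1 n1; have wu' := nw u' e2 De2 ed2 d2 n2.
have [a [b [aN bN ab [wa va] [wb vb]]]] := walk_nbrs (pos_le v).
have uu' : pos u != pos u'.
  by apply: contraNneq ne => E; rewrite De1 De2 -(posK u) E posK.
have := @adj_nbr (pos v) a b (pos u) (pos u').
rewrite /adj_at /= !posK; rewrite /adj_at /= posK in va vb.
move=> /(_ va vb vu vu' aN bN (pos_le u) (pos_le u')).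
have ne_w x y : walk (pos v) x -> ~~ walk (pos v) y -> x != y.
  by move=> wx; apply: contraNneq => <-.
rewrite /= !inE negb_or ab (ne_w _ _ wa wu) (ne_w _ _ wb wu) => /(_ isT).
by rewrite eq_sym (negPf (ne_w _ _ wa wu')) eq_sym (negPf (ne_w _ _ wb wu')) eq_sym (negPf uu').
Qed.

Lemma decompose_cycle c (r : rel nat) :
  2 < size c -> uniq c -> cycle (@edge G) c ->
  (forall x y, connect (off (cedges c)) x y) ->
  (forall s t, s <= N -> t <= N -> walk s t ->
    [set at_ s; at_ t] \notin cedges c -> r s t) ->
  acyclic_rel r -> decomposable G.
Proof.
move=> c2 Uc cyc_c conn sub_r ar.
have cov : cover [set cedges c] = cedges c by rewrite /cover big_set1.
apply: (decompose_cycles (CC := [set cedges c])) ar; rewrite ?cov //.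
  by move=> C; rewrite inE => /eqP->; exists c.
by apply/trivIsetP => C1 C2; rewrite !inE => /eqP-> /eqP->; rewrite eqxx.
Qed.

End Numbered.

(* Arithmetic on positions; hypotheses on the graph only slow it down. *)
Ltac plia := repeat match goal with
  | H : forall _, _ |- _ => clear H
  | H : is_true (connect _ _ _) |- _ => clear H
  | H : is_true (adj_at _ _ _) |- _ => clear H
  | H : is_true (uniq _) |- _ => clear H
  | H : is_true (cycle _ _) |- _ => clear H
  | H : is_true (2 < size _) |- _ => clear H
  | H : is_true (_ \in _) |- _ => clear H
  | H : is_true (_ \notin _) |- _ => clear H
  | H : connect_sym _ |- _ => clear H
  | H : cubic _ |- _ => clear H
  end; lia.

(** * Monotone runs of numbers *)

Lemma path_up (r : rel nat) x m :
  (forall t, x <= t < x + m -> r t t.+1) -> path r x (iota x.+1 m).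
Proof.
elim: m x => //= m IH x H; rewrite H ?IH //; last by lia.
by move=> t ht; apply: H; lia.
Qed.

Lemma last_up x m : last x (iota x.+1 m) = x + m.
Proof. by elim: m x => [|m IH] x /=; rewrite ?addn0 // IH addSnnS. Qed.

Definition down x m := [seq x - i | i <- iota 0 m].

Lemma downS x m : down x m.+1 = x :: [seq x - i | i <- iota 1 m].
Proof. by rewrite /down /= subn0. Qed.

Lemma mem_down x m t : m <= x.+1 -> (t \in down x m) = (x < t + m) && (t <= x).
Proof.
move=> mx; apply/mapP/idP => [[i]|h]; first by rewrite mem_iota => hi ->; lia.
by exists (x - t); rewrite ?mem_iota; lia.
Qed.

Lemma uniq_down x m : m <= x.+1 -> uniq (down x m).
Proof.
move=> mx; rewrite map_inj_in_uniq ?iota_uniq // => s t.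
by rewrite !mem_iota => hs ht; lia.
Qed.

Lemma path_down (r : rel nat) x m :
  (forall t, t < m -> r (x - t) (x - t.+1)) ->
  path r x [seq x - i | i <- iota 1 m].
Proof.
move=> H; rewrite -[X in path _ X]subn0 (path_map (f := fun i => x - i)).
by apply: path_up => t ht; apply: H.
Qed.

Lemma last_down x m : last x [seq x - i | i <- iota 1 m] = x - m.
Proof. by rewrite -[X in last X]subn0 last_map last_up. Qed.

(** * Cycles formed by a chord and the path between its ends *)

Section Intervals.

Variables (G : sgraph) (N : nat) (at_ : nat -> G).
Hypothesis G3 : cubic G.
Hypothesis ham : ham_order N at_.
Local Notation adj := (adj_at at_).

Lemma at_cycle (s : seq nat) : (forall t, t \in s -> t <= N) -> uniq s -> cycle adj s ->
  uniq (map at_ s) /\ cycle (@edge G) (map at_ s).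
Proof.
move=> sN Us cyc_s; rewrite cycle_map map_inj_in_uniq // => p q ps qs.
by apply: (at_inj ham); apply: sN.
Qed.

Lemma mem_at (s : seq nat) t : (forall t, t \in s -> t <= N) -> t <= N ->
  (at_ t \in map at_ s) = (t \in s).
Proof.
move=> sN tN; apply/mapP/idP => [[u us /(at_inj ham)->]|ts] //; first exact: sN.
by exists t.
Qed.

Definition ivl x y := map at_ (iota x (y - x).+1).

Lemma mem_ivl x y t : x <= y -> y <= N -> t <= N ->
  (at_ t \in ivl x y) = (x <= t <= y).
Proof.
move=> xy yN tN; rewrite mem_at // => [|u]; rewrite mem_iota; last by lia.
by apply/idP/idP; lia.
Qed.

Lemma ivl_cycle x y : x.+1 < y -> y <= N -> adj x y ->
  [/\ 2 < size (ivl x y), uniq (ivl x y) & cycle (@edge G) (ivl x y)].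
Proof.
move=> xy yN axy; rewrite size_map size_iota; split; first lia.
  by rewrite map_inj_in_uniq ?iota_uniq // => p q;
     rewrite !mem_iota => hp hq; apply: (at_inj ham); lia.
rewrite cycle_map /= rcons_path path_up => [|t ht]; last first.
  by apply: (adjS ham); lia.
by rewrite last_up /= edge_sym subnKC //; lia.
Qed.

Lemma ivl_first x y : x < y -> [set at_ x; at_ x.+1] \in cedges (ivl x y).
Proof.
move=> xy; apply/imsetP; exists (at_ x); first by rewrite mem_head.
by rewrite /ivl; have -> : y - x = (y - x.+1).+1; [lia|rewrite /= eqxx].
Qed.

Definition cut_path a b : rel nat := [rel s t |
  (t == s.+1) && (s != a) && (s != b) || (s == t.+1) && (t != a) && (t != b)].

Lemma acyclic_cut_path a b : acyclic_rel (cut_path a b).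
Proof.
apply: acyclic_rel_sub acyclic_succ => s t /=.
by case/orP=> /andP[/andP[-> _] _]; rewrite ?orbT.
Qed.

Lemma acyclic_cut1 a b j : a < j -> acyclic_rel (add_edge (cut_path a b) 0 j).
Proof.
move=> aj; apply: (acyclic_rel_add (A := fun s => s <= a)).
- by rewrite /cut_path /= => s t h; apply/idP/idP; lia.
- by lia.
exact: acyclic_cut_path.
Qed.

(** The two cuts split the path into three segments. The edges [0j] and [Nk]
    join them into one path unless they both join the outer two. *)
Lemma acyclic_cut2 a b j k : a < b < N -> a < j -> k <= b ->
  (j <= b) || (a < k) ->
  acyclic_rel (add_edge (add_edge (cut_path a b) 0 j) N k).
Proof.
move=> abN aj kb jk.
case: (leqP j b) => jb.
  apply: (acyclic_rel_add (A := fun s => s <= b)); last exact: acyclic_cut1.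
    by rewrite /add_edge /cut_path /= => s t h; apply/idP/idP; lia.
  by lia.
apply: (acyclic_rel_add (A := fun s => a < s <= b)); last exact: acyclic_cut1.
  by rewrite /add_edge /cut_path /= => s t h; apply/idP/idP; lia.
by lia.
Qed.

Lemma walk_cut a b j k s t : walk N j k s t ->
  (t = s.+1 -> s != a /\ s != b) -> (s = t.+1 -> t != a /\ t != b) ->
  add_edge (add_edge (cut_path a b) 0 j) N k s t.
Proof.
rewrite /walk /add_edge /cut_path /=.
case/or3P=> [/eqP E /(_ E)[-> ->] _|/eqP E _ /(_ E)[-> ->]|].
- by rewrite E eqxx.
- by rewrite E eqxx !orbT.
by case/or4P=> -> _ _; rewrite ?orbT.
Qed.

Lemma connect_run D x y t : x <= t <= y ->
  (forall s, x <= s < y -> off D (at_ s) (at_ s.+1)) ->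
  connect (off D) (at_ x) (at_ t).
Proof.
move=> xty H; apply/connectP; exists (map at_ (iota x.+1 (t - x))).
  by rewrite path_map; apply: path_up => s hs; apply: H; lia.
by rewrite last_map last_up subnKC //; lia.
Qed.

Variables j k : nat.
Hypotheses (j1 : 1 < j) (jN : j <= N) (kN : k.+1 < N).
Hypotheses (adj0j : adj 0 j) (adjNk : adj N k).

(** Removing the two cycles cuts the path into three segments. The conditions on
    [j] and [k] say that the edges [0j] and [Nk] join them into one tree; the
    inner vertices of the two intervals hang on that tree by edges that leave
    their interval. *)
Lemma two_intervals x y x' y' :
  x.+1 < y -> y < x' -> x'.+1 < y' -> y' <= N -> adj x y -> adj x' y' ->
  y < j -> k < x' -> (j <= x') || (y' <= j) -> (k <= x) || (y <= k) ->
  (j <= x') || (y <= k) ->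
  (forall z, x < z < y -> exists t,
     [/\ t <= N, adj z t, ~~ (x <= t <= y) & ~~ (x' < t < y')]) ->
  (forall z, x' < z < y' -> exists t,
     [/\ t <= N, adj z t, ~~ (x' <= t <= y') & ~~ (x < t < y)]) ->
  decomposable G.
Proof.
move=> xy yx' xy' yN axy axy' yj kx' hj hk hjk out1 out2.
have [s1 U1 cyc1] : [/\ 2 < size (ivl x y), uniq (ivl x y) & cycle (@edge G) (ivl x y)].
  by apply: ivl_cycle => //; plia.
have [s2 U2 cyc2] := ivl_cycle xy' yN axy'.
set c1 := ivl x y in s1 U1 cyc1; set c2 := ivl x' y' in s2 U2 cyc2.
pose CC : {set {set {set G}}} := [set cedges c1; cedges c2].
have coverE e : (e \in cover CC) = (e \in cedges c1) || (e \in cedges c2).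
  by rewrite /cover bigcup_setU !big_set1 inE.
have in1 t : t <= N -> (at_ t \in c1) = (x <= t <= y).
  by move=> tN; rewrite mem_ivl; plia.
have in2 t : t <= N -> (at_ t \in c2) = (x' <= t <= y').
  by move=> tN; rewrite mem_ivl; plia.
have offP s t : s <= N -> t <= N -> adj s t ->
    ~~ [&& x <= s <= y & x <= t <= y] -> ~~ [&& x' <= s <= y' & x' <= t <= y'] ->
    off (cover CC) (at_ s) (at_ t).
  move=> sN tN st n1 n2; rewrite /off /= [edge _ _]st coverE negb_or /=.
  by apply/andP; split; [apply: contra n1|apply: contra n2];
    move/cedges_ends=> []; rewrite ?in1 ?in2 // => -> ->.
have Osym : connect_sym (off (cover CC)) by apply: connect_off_sym.
have linkj : connect (off (cover CC)) (at_ 0) (at_ j).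
  by apply: connect1; apply: offP; [plia|plia|exact: adj0j|plia|plia].
have linkk : connect (off (cover CC)) (at_ N) (at_ k).
  by apply: connect1; apply: offP; [plia|plia|exact: adjNk|plia|plia].
have run a b t : a <= t <= b -> b <= N ->
    (b <= x) || ((y <= a) && (b <= x')) || (y' <= a) ->
    connect (off (cover CC)) (at_ a) (at_ t).
  move=> atb bN h; apply: (connect_run atb) => s hs.
  by apply: offP; [plia|plia|apply: (adjS ham); plia|plia|plia].
have core t : t <= N -> ~~ (x < t < y) -> ~~ (x' < t < y') ->
    connect (off (cover CC)) (at_ y) (at_ t).
  have segA s : s <= x -> connect (off (cover CC)) (at_ 0) (at_ s).
    by move=> sx; apply: (@run 0 x); plia.
  have segB s : y <= s <= x' -> connect (off (cover CC)) (at_ y) (at_ s).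
    by move=> sx; apply: (@run y x'); plia.
  have segC s : y' <= s <= N -> connect (off (cover CC)) (at_ N) (at_ s).
    move=> sx; apply: (@connect_trans _ _ (at_ y')).
      by rewrite Osym; apply: (@run y' N); plia.
    by apply: (@run y' N); plia.
  have zero_y : connect (off (cover CC)) (at_ y) (at_ 0).
    case: (leqP j x') => jx.
      by apply: connect_trans (segB j _) _; [plia|rewrite Osym].
    apply: connect_trans (segB k _) _; first plia.
    rewrite Osym in linkk; apply: connect_trans linkk _.
    by apply: connect_trans (segC j _) _; [plia|rewrite Osym].
  have N_y : connect (off (cover CC)) (at_ y) (at_ N).
    case: (leqP y k) => ky.
      by apply: connect_trans (segB k _) _; [plia|rewrite Osym].
    apply: connect_trans zero_y _; apply: connect_trans (segA k _) _; first plia.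
    by rewrite Osym.
  move=> tN n1 n2; case: (leqP t x) => tx.
    by apply: connect_trans zero_y (segA _ tx).
  case: (leqP t x') => tx'; first by apply: segB; plia.
  by apply: connect_trans N_y (segC _ _); plia.
have conn t : t <= N -> connect (off (cover CC)) (at_ y) (at_ t).
  move=> tN; have [h1|n1] := boolP (x < t < y).
    have [u [uN tu nu nu']] := out1 t h1.
    apply: connect_trans (core u uN _ nu') _; first plia.
    by rewrite Osym; apply: connect1; apply: offP; [plia|plia|exact: tu|plia|plia].
  have [h2|n2] := boolP (x' < t < y'); last by apply: core.
  have [u [uN tu nu nu']] := out2 t h2.
  apply: connect_trans (core u uN nu' _) _; first plia.
  by rewrite Osym; apply: connect1; apply: offP; [plia|plia|exact: tu|plia|plia].
have vdisj v : v \in c1 -> v \notin c2.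
  by rewrite -(posK ham v) in1 ?in2 ?(pos_le ham) //; plia.
apply: (decompose_cycles G3 ham j1 jN kN adj0j adjNk (CC := CC)
  (r := add_edge (add_edge (cut_path x x') 0 j) N k)).
- by move=> C; rewrite !inE => /orP[] /eqP->; [exists c1|exists c2].
- apply/trivIsetP => C1 C2; rewrite !inE.
  have dis : [disjoint cedges c1 & cedges c2].
    rewrite disjoint_subset; apply/subsetP=> e /imsetP[v vc1 ->]; apply/negP.
    by case/cedges_ends => /(contraL (vdisj v)); rewrite vc1.
  by move=> /orP[]/eqP-> /orP[]/eqP-> //; rewrite ?eqxx // disjoint_sym.
- move=> u v; rewrite -(posK ham u) -(posK ham v).
  apply: (@connect_trans _ _ (at_ y)); first by rewrite Osym conn ?(pos_le ham).
  by rewrite conn ?(pos_le ham).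
- have f1 : [set at_ x; at_ x.+1] \in cover CC.
    by rewrite coverE ivl_first //; plia.
  have f2 : [set at_ x'; at_ x'.+1] \in cover CC.
    by rewrite coverE orbC ivl_first //; plia.
  move=> s t sN tN wst nst.
  apply: walk_cut wst _ _ => E; subst; split; apply: contraNneq nst => ->//.
    by rewrite setUC.
  by rewrite setUC.
by apply: acyclic_cut2; plia.
Qed.

End Intervals.

(** * Innermost chords and intervals closed under chords *)

Section Closed.

Variables (G : sgraph) (N : nat) (at_ : nat -> G).
Hypothesis G3 : cubic G.
Hypothesis ham : ham_order N at_.
Local Notation adj := (adj_at at_).
Definition innermost x y := [/\ x.+1 < y, adj x y
  & forall s t, x <= s -> t <= y -> s.+1 < t -> adj s t -> s = x /\ t = y].

Lemma innermost_ex a b s t : a <= s -> t <= b -> s.+1 < t -> adj s t ->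
  exists x y, [/\ a <= x, y <= b & innermost x y].
Proof.
have [m] := ubnP (t - s); elim: m s t => // m IH s t ltm a_s tb st ast.
pose P u v := [&& s <= u, v <= t, u.+1 < v, adj u v & ~~ ((u == s) && (v == t))].
have [/hasP[u _ /hasP[v _ /and5P[su vt uv auv ne]]]|no] :=
  boolP (has (fun u => has (P u) (iota 0 t.+1)) (iota 0 t.+1)).
  by apply: (IH u v) => //; plia.
exists s, t; split=> //; split=> // u v su vt uv auv.
have [/andP[/eqP-> /eqP->] //|ne] := boolP ((u == s) && (v == t)).
case/hasP: no; exists u; first by rewrite mem_iota; plia.
apply/hasP; exists v; first by rewrite mem_iota; plia.
by rewrite /P su vt uv auv ne.
Qed.

Variables j k : nat.
Hypotheses (j1 : 1 < j) (jN : j <= N) (kN : k.+1 < N).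
Hypotheses (adj0j : adj 0 j) (adjNk : adj N k).
Local Notation walk := (walk N j k).

(** The edge at [z] outside the walk would be a shorter chord if it stayed in the
    interval. *)
Lemma innermost_out x y z : innermost x y -> y <= N -> x < z < y ->
  z != j -> z != k ->
  exists t, [/\ t <= N, adj z t, ~~ walk z t & ~~ (x <= t <= y)].
Proof.
case=> xy axy inn yN xzy zj zk.
have [|t [tN zt nw]] := chord_ex G3 ham j1 jN kN adj0j adjNk _ zj zk; first by plia.
exists t; split=> //; apply/negP => xty.
have [tz|zt'|E] := ltngtP t z; last by rewrite E (adj_irr at_) in zt.
  have := inn t z; rewrite adj_sym zt; move: nw; rewrite /walk /= => nw /(_ _ _ _ isT) H.
  have [] : t = x /\ z = y by apply: H; plia.
  by plia.
have := inn z t; rewrite zt; move: nw; rewrite /walk /= => nw /(_ _ _ _ isT) H.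
have [] : z = x /\ t = y by apply: H; plia.
by plia.
Qed.

Definition chord_closed a b := [/\ a <= b <= N, ~~ (a <= j <= b), ~~ (a <= k <= b)
  & forall s t, a <= s <= b -> t <= N -> adj s t -> ~~ walk s t -> a <= t <= b].

(** The edge at [a] outside the walk is a chord of the interval. *)
Lemma chord_closed_innermost a b : chord_closed a b ->
  exists x y, [/\ a <= x, y <= b, innermost x y
    & forall z, x < z < y ->
        exists t, [/\ t <= N, adj z t, ~~ (x <= t <= y) & a <= t <= b]].
Proof.
case=> abN ja ka clos.
have [t [tN at' nw]] : exists t, [/\ t <= N, adj a t & ~~ walk a t].
  by apply: (chord_ex G3 ham) => //; plia.
have atb : a <= t <= b by apply: (clos a t) => //; plia.
have at1 : a.+1 < t.
  move: nw at'; rewrite /walk /=; have [->|] := eqVneq t a; last by plia.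
  by rewrite (adj_irr at_).
have [x [y [ax yb inn]]] : exists x y, [/\ a <= x, y <= b & innermost x y].
  by apply: (innermost_ex (leqnn a) _ at1 at'); plia.
exists x, y; split=> // z xzy.
have [u [uN zu nwu nu]] : exists u, [/\ u <= N, adj z u, ~~ walk z u & ~~ (x <= u <= y)].
  by apply: (innermost_out inn _ xzy); plia.
by exists u; split=> //; apply: (clos z u) => //; plia.
Qed.

Lemma two_closed a b a' b' : chord_closed a b -> chord_closed a' b' ->
  b < a' -> b < j -> k < a' -> (j < a') || (b' < j) -> (k < a) || (b < k) ->
  (j < a') || (b < k) -> decomposable G.
Proof.
move=> clos clos' ba' bj ka' h1 h2 h3.
have [x [y [ax yb [xy axy _] out]]] := chord_closed_innermost clos.
have [x' [y' [ax' yb' [xy' axy' _] out']]] := chord_closed_innermost clos'.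
case: clos clos' => /andP[ab bN] _ _ _ [/andP[ab' bN'] _ _ _].
apply: (two_intervals G3 ham j1 jN kN adj0j adjNk (x := x) (y := y)
  (x' := x') (y' := y')) => //; try plia.
  move=> z /out[t [tN zt nt tb]]; exists t; split=> //; plia.
by move=> z /out'[t [tN zt nt tb]]; exists t; split=> //; plia.
Qed.

(** Each end of a run of [X] along the walk contributes an edge that leaves
    [X], so two such edges leave room for one run only. *)
Lemma small_cut_closed X f g : X != set0 -> small_cut X f g ->
  at_ j \notin X -> at_ k \notin X ->
  exists a b, chord_closed a b /\ forall t, t <= N -> (at_ t \in X) = (a <= t <= b).
Proof.
case/set0Pn=> v vX cutX jX kX.
pose P t := (t <= N) && (at_ t \in X).
have exP : exists t, P t by exists (pos N at_ v); rewrite /P (pos_le ham) (posK ham).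
have ubP t : P t -> t <= N by case/andP.
case: (ex_minnP exP) => a /andP[aN aX] min_a.
case: (ex_maxnP exP ubP) => b /andP[bN bX] max_b.
have {}min_a t : t <= N -> at_ t \in X -> a <= t.
  by move=> tN tX; apply: min_a; rewrite /P tN.
have {}max_b t : t <= N -> at_ t \in X -> t <= b.
  by move=> tN tX; apply: max_b; rewrite /P tN.
have ab : a <= b by apply: min_a.
pose p := if a == 0 then j else a.-1.
pose q := if b == N then k else b.+1.
have pN : p <= N by rewrite /p; case: ifP => _; plia.
have qN : q <= N by rewrite /q; case: ifP => h; plia.
have pX : at_ p \notin X.
  rewrite /p; case: ifP => // h; apply/negP => /min_a H.
  by have := H _; plia.
have qX : at_ q \notin X.
  rewrite /q; case: ifP => // h; apply/negP => /max_b H.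
  by have := H _; plia.
have ap : adj a p.
  by rewrite /p; case: eqP => [->|h] //; apply: (adjP ham); plia.
have bq : adj b q.
  by rewrite /q; case: eqP => [->|h] //; apply: (adjS ham); plia.
have e12 : [set at_ a; at_ p] <> [set at_ b; at_ q].
  case/eq_set2=> [] [/(at_inj ham) E1 /(at_inj ham) E2].
    have {}E1 := E1 aN bN; have {}E2 := E2 pN qN.
    by move: E2; rewrite /p /q; do 2![case: eqP => ?]; plia.
  by rewrite (E1 aN qN) in aX; rewrite aX in qX.
have only s t : s <= N -> t <= N -> adj s t -> at_ s \in X -> at_ t \notin X ->
    s = a /\ t = p \/ s = b /\ t = q.
  move=> sN tN st sX tX.
  have E : [set at_ s; at_ t] = [set at_ a; at_ p] \/
           [set at_ s; at_ t] = [set at_ b; at_ q].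
    have := cutX _ _ aX pX ap; have := cutX _ _ bX qX bq.
    have := cutX _ _ sX tX st.
    by do 3![case=> ?]; try (by left; congruence); try (by right; congruence);
      case: e12; congruence.
  case: E => /eq_set2[[/(at_inj ham) E1 /(at_inj ham) E2]|[E1 _]].
  - by left; rewrite (E1 sN aN) (E2 tN pN).
  - by rewrite -E1 sX in pX.
  - by right; rewrite (E1 sN bN) (E2 tN qN).
  by rewrite -E1 sX in qX.
have memX t : t <= N -> (at_ t \in X) = (a <= t <= b).
  move=> tN; apply/idP/idP => [tX|atb]; first by rewrite min_a ?max_b.
  elim: t tN atb => [|t IH] tN atb; first by have <- : a = 0 by plia.
  have [<- //|ne] := eqVneq a t.+1.
  have tX : at_ t \in X by apply: IH; plia.
  apply: contraT => tX'.
  have := only t t.+1 _ tN (adjS ham _) tX tX'; rewrite /p.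
  by case: eqP; plia.
exists a, b; split=> //; split.
- by rewrite ab.
- by rewrite -memX.
- by rewrite -memX //; plia.
move=> s t asb tN st nw; rewrite -memX //; apply: contraNT nw => tX.
have sX : at_ s \in X by rewrite memX //; plia.
have sN : s <= N by plia.
have wp : walk a p.
  by rewrite /walk /= /p; case: (a =P 0) => [->|h]; [rewrite !eqxx !orbT|plia].
have wq : walk b q.
  by rewrite /walk /= /q; case: (b =P N) => [->|h]; [rewrite !eqxx !orbT|plia].
by case: (only s t sN tN st sX tX) => [] [-> ->].
Qed.

End Closed.

(** * Hamiltonian graphs *)

Section Hamiltonian.

Variables (G : sgraph) (N : nat) (at_ : nat -> G).
Hypothesis G3 : cubic G.
Hypothesis ham : ham_order N at_.
Local Notation adj := (adj_at at_).

(** With [j = N] and [k = 0] the walk is a Hamiltonian cycle, and the interval of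
    any innermost chord serves. *)
Lemma hamiltonian_decomposable : 1 < N -> adj 0 N -> decomposable G.
Proof.
move=> N1 a0N.
have aN0 : adj N 0 by rewrite adj_sym.
have [i [iN a0i i1 iNN]] : exists i, [/\ i <= N, adj 0 i, i != 1 & i != N].
  by apply: (adj_third G3 ham _ a0N); [apply: (adjS ham); plia|plia|plia|plia].
have i0 : i != 0 by apply: contraTneq a0i => ->; rewrite adj_irr.
have [x [y [_ yi inn]]] : exists x y, [/\ 0 <= x, y <= i & innermost at_ x y].
  by apply: (innermost_ex _ _ _ a0i); plia.
have [xy axy _] := inn.
have N0 : 1 < N by []; have NN : N <= N by [].
have [s1 U1 cyc1] : [/\ 2 < size (ivl at_ x y), uniq (ivl at_ x y)
    & cycle (@edge G) (ivl at_ x y)] by apply: (ivl_cycle ham) => //; plia.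
set c1 := ivl at_ x y in s1 U1 cyc1.
have offP s t : s <= N -> t <= N -> adj s t -> ~~ [&& x <= s <= y & x <= t <= y] ->
    off (cedges c1) (at_ s) (at_ t).
  move=> sN tN st; rewrite /off /= [edge _ _]st; apply: contra => /cedges_ends[].
  by rewrite !(mem_ivl ham) //; plia.
have Osym : connect_sym (off (cedges c1)) by apply: connect_off_sym.
have core t : t <= N -> ~~ (x < t < y) -> connect (off (cedges c1)) (at_ 0) (at_ t).
  move=> tN nt; case: (leqP t x) => tx.
    by apply: (connect_run (y := x)) => [|s hs]; [plia|apply: offP; [plia|plia|apply: (adjS ham); plia|plia]].
  apply: (@connect_trans _ _ (at_ N)); first by apply: connect1; apply: offP; [plia|plia|exact: a0N|plia].
  apply: (@connect_trans _ _ (at_ y)).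
    by rewrite Osym; apply: (connect_run (y := N)) => [|s hs]; [plia|apply: offP; [plia|plia|apply: (adjS ham); plia|plia]].
  by apply: (connect_run (y := N)) => [|s hs]; [plia|apply: offP; [plia|plia|apply: (adjS ham); plia|plia]].
apply: (decompose_cycle G3 ham N1 NN N1 a0N aN0 s1 U1 cyc1
  (r := add_edge (cut_path x x) 0 N)).
- have conn t : t <= N -> connect (off (cedges c1)) (at_ 0) (at_ t).
    move=> tN; have [h|] := boolP (x < t < y); last exact: core.
    have [u [uN tu _ nu]] : exists u, [/\ u <= N, adj t u, ~~ walk N N 0 t u
        & ~~ (x <= u <= y)].
      by apply: (innermost_out G3 ham N1 NN N1 a0N aN0 inn); plia.
    apply: connect_trans (core u uN _) _; first plia.
    by rewrite Osym; apply: connect1; apply: offP; [plia|plia|exact: tu|plia].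
  move=> u v; rewrite -(posK ham u) -(posK ham v).
  apply: (@connect_trans _ _ (at_ 0)); first by rewrite Osym conn ?(pos_le ham).
  by rewrite conn ?(pos_le ham).
- have f1 : [set at_ x; at_ x.+1] \in cedges c1 by rewrite ivl_first //; plia.
  move=> s t sN tN wst nst.
  have : add_edge (add_edge (cut_path x x) 0 N) N 0 s t.
    apply: walk_cut wst _ _ => E; subst; split; apply: contraNneq nst => ->//;
      by rewrite setUC.
  rewrite {1}/add_edge /= => /or3P[//|/andP[/eqP-> /eqP->]|/andP[/eqP-> /eqP->]];
    by rewrite /add_edge /= !eqxx !orbT.
by apply: acyclic_cut1; plia.
Qed.

End Hamiltonian.

(** * Overlapping end cycles *)

Section Theta.

Variables (G : sgraph) (N : nat) (at_ : nat -> G).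
Hypothesis G3 : cubic G.
Hypothesis ham : ham_order N at_.
Local Notation adj := (adj_at at_).
Variables j k : nat.
Hypotheses (k0 : 0 < k) (kj : k < j) (jltN : j < N).
Hypotheses (adj0j : adj 0 j) (adjNk : adj N k).
Local Notation walk := (walk N j k).

Let j1 : 1 < j. Proof. by plia. Qed.
Let jN : j <= N. Proof. by plia. Qed.
Let kN : k.+1 < N. Proof. by plia. Qed.

Lemma off_notin (c : seq G) x y : edge x y -> x \notin c -> off (cedges c) x y.
Proof.
by move=> xy xc; rewrite /off /= xy; apply: contra xc => /cedges_ends[].
Qed.

(** The cycle contains two of the three edges of the walk at the branch vertex
    [k], and what is left of the walk then has no cycle. *)
Lemma theta_cycle c : 2 < size c -> uniq c -> cycle (@edge G) c ->
  at_ k \in c -> (forall x y, connect (off (cedges c)) x y) -> decomposable G.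
Proof.
move=> c2 Uc cyc_c kc conn.
pose P t := [set at_ k; at_ t] \in cedges c.
have nbr u : edge (at_ k) u -> pos N at_ u \in [:: k.-1; k.+1; N].
  move=> ku; apply: (adj_nbr G3 ham (s := k)).
  - by apply: (adjP ham); plia.
  - by apply: (adjS ham); plia.
  - by rewrite adj_sym.
  - by rewrite /adj_at /= (posK ham).
  - by plia.
  - by plia.
  - by plia.
  - exact: (pos_le ham).
  by rewrite /= !inE; plia.
have Pn : P (pos N at_ (next c (at_ k))) by rewrite /P (posK ham) next_cedges.
have Pp : P (pos N at_ (prev c (at_ k))) by rewrite /P (posK ham) prev_cedges.
have np : pos N at_ (next c (at_ k)) <> pos N at_ (prev c (at_ k)).
  move=> E; have /eqP[] := next_prev_neq c2 Uc kc.
  by rewrite -(posK ham (next _ _)) E (posK ham).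
have two : [\/ P k.-1 /\ P k.+1, P k.-1 /\ P N | P k.+1 /\ P N].
  move: Pn Pp np (nbr _ (next_cycle cyc_c kc)).
  have := nbr (prev c (at_ k)); rewrite edge_sym prev_cycle // => /(_ isT).
  move: (pos N at_ (next _ _)) (pos N at_ (prev _ _)) => s t.
  rewrite !inE => /or3P[] /eqP-> Ps Pt st /or3P[] /eqP E; subst;
    by [case: st|constructor].
have inP s t : [set at_ s; at_ t] \notin cedges c -> s = k -> ~~ P t.
  by move=> nst sk; rewrite sk in nst.
case: two => [[P1 P2]|[P1 P3]|[P2 P3]].
- apply: (decompose_cycle G3 ham j1 jN kN adj0j adjNk c2 Uc cyc_c conn
    (r := add_edge (add_edge (cut_path k.-1 k) 0 j) N k)); last first.
    by apply: acyclic_cut2; plia.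
  move=> s t sN tN wst nst.
  apply: walk_cut wst _ _ => E; subst; split; apply: contraNneq nst => E.
  + by rewrite setUC (_ : s.+1 = k) ?E //; plia.
  + by rewrite E.
  + by rewrite (_ : t.+1 = k) ?E //; plia.
  by rewrite E setUC.
- apply: (decompose_cycle G3 ham j1 jN kN adj0j adjNk c2 Uc cyc_c conn
    (r := add_edge (cut_path k.-1 k.-1) 0 j)); last by apply: acyclic_cut1; plia.
  move=> s t sN tN wst nst.
  have : add_edge (add_edge (cut_path k.-1 k.-1) 0 j) N k s t.
    apply: walk_cut wst _ _ => E; subst; split; apply: contraNneq nst => E.
    + by rewrite setUC (_ : s.+1 = k) ?E //; plia.
    + by rewrite setUC (_ : s.+1 = k) ?E //; plia.
    + by rewrite (_ : t.+1 = k) ?E //; plia.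
    by rewrite (_ : t.+1 = k) ?E //; plia.
  case/or3P=> [//|/andP[/eqP E1 /eqP E2]|/andP[/eqP E1 /eqP E2]]; case/negP: nst; subst.
    by rewrite setUC.
  by [].
apply: (decompose_cycle G3 ham j1 jN kN adj0j adjNk c2 Uc cyc_c conn
  (r := add_edge (cut_path k k) 0 j)); last by apply: acyclic_cut1; plia.
move=> s t sN tN wst nst.
have : add_edge (add_edge (cut_path k k) 0 j) N k s t.
  apply: walk_cut wst _ _ => E; subst; split; apply: contraNneq nst => E.
  + by rewrite E.
  + by rewrite E.
  + by rewrite E setUC.
  by rewrite E setUC.
case/or3P=> [//|/andP[/eqP E1 /eqP E2]|/andP[/eqP E1 /eqP E2]]; case/negP: nst; subst.
  by rewrite setUC.
by [].
Qed.

(** Rerouting never removes [k], the first vertex of the cycle. *)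
Lemma theta_grow S b q : good_cycle S (at_ k) b q -> at_ j \in S ->
  decomposable G \/ exists a' b', chord_closed N at_ j k a' b' /\
    forall t, t <= N -> (t == k) || (at_ t \in S) -> ~~ (a' <= t <= b').
Proof.
move=> gq jS; case: (grow G3 gq) => [[q' [[Uq cyc_q s2 _ _] conn]]|[X [f [g [X0 SX kX cutX]]]]].
  left; apply: (theta_cycle s2 Uq cyc_q) => [|x y]; first exact: mem_head.
  by apply: connect_trans (conn y); rewrite connect_off_sym; apply: conn.
have nX v : v \in S -> v \notin X by move=> vS; rewrite (disjointFr SX vS).
right; have [a' [b' [clos memX]]] := small_cut_closed ham j1 jN kN adj0j adjNk X0 cutX (nX _ jS) kX.
exists a', b'; split=> // t tN; rewrite -memX //.
by case/orP=> [/eqP->|/nX].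
Qed.

Definition closed_avoiding (Q : pred nat) :=
  exists a b, chord_closed N at_ j k a b /\
    forall t, t <= N -> Q t -> ~~ (a <= t <= b).

(** The walk consists of three paths between [k] and [j]: one through [0], one
    through [N], and the part of the original path between [k] and [j]. In
    each of the next three lemmas the cycle formed by two of them is rerouted,
    while the third stays connected. *)
Lemma theta_right : decomposable G \/
  closed_avoiding [pred t | (t <= k) || (t == j)].
Proof.
pose c := ivl at_ k N.
have [s2 Uc cyc_c] : [/\ 2 < size c, uniq c & cycle (@edge G) c].
  by apply: (ivl_cycle ham); rewrite ?[adj k N]adj_sym //; plia.
have memc t : t <= N -> (at_ t \in c) = (k <= t).
  by move=> tN; rewrite (mem_ivl ham) //; plia.
pose S := [set v | (pos N at_ v <= k) || (pos N at_ v == j)].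
have good : good_cycle S (at_ k) (at_ N) (map at_ (iota k.+1 (N - k))).
  split=> //; first by rewrite last_map last_up subnKC //; plia.
  have conn t : t <= k -> connect (off (cedges c)) (at_ k) (at_ t).
    move=> tk; rewrite connect_off_sym; apply: (connect_run (y := k)) => [|s hs]; first plia.
    by apply: off_notin; [apply: (adjS ham)|rewrite memc]; plia.
  move=> v; rewrite inE -{3}(posK ham v) => /orP[/conn //|/eqP->].
  apply: connect_trans (conn 0 _) (connect1 _) => //.
  by apply: off_notin => //; rewrite memc; plia.
have [|//|[a [b [clos av]]]] := theta_grow good; first by rewrite inE (atK ham) ?eqxx ?orbT.
  by left.
right; exists a, b; split=> // t tN /= h; apply: av => //.
by rewrite inE (atK ham) // h orbT.
Qed.

Lemma theta_left : decomposable G \/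
  closed_avoiding [pred t | (t == k) || (j <= t)].
Proof.
pose s := iota k (j - k).+1 ++ iota 0 k; pose c := map at_ s.
have sN t : t \in s -> t <= N by rewrite mem_cat !mem_iota; plia.
have memc t : t <= N -> (at_ t \in c) = (t <= j).
  move=> tN; rewrite (mem_at ham) // mem_cat !mem_iota.
  by apply/idP/idP; plia.
have [Uc cyc_c] : uniq c /\ cycle (@edge G) c.
  apply: (at_cycle ham) => //.
    rewrite cat_uniq !iota_uniq andbT andTb; apply/hasPn => t t2.
    apply/negP => t1; move: (t1 : t \in iota k _) t2.
    by rewrite !mem_iota; plia.
  rewrite /s /= rcons_cat cat_path path_up; last first.
    by move=> t ht; apply: (adjS ham); plia.
  rewrite last_up subnKC; last by plia.
  rewrite -[iota 0 k]/(iota 0 k) -(prednK k0) /= adj_sym adj0j rcons_path path_up.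
    by rewrite last_up add0n; apply: (adjS ham); plia.
  by move=> t ht; apply: (adjS ham); plia.
pose S := [set v | (pos N at_ v == k) || (j <= pos N at_ v)].
have good : good_cycle S (at_ k) (at_ k.-1) (map at_ (iota k.+1 (j - k) ++ iota 0 k)).
  split=> //.
  - by rewrite /= size_map size_cat !size_iota; plia.
  - by rewrite last_map last_cat -(prednK k0) /= last_up.
  have conn t : j <= t <= N -> connect (off (cedges c)) (at_ k) (at_ t).
    move=> jt; apply: (@connect_trans _ _ (at_ N)).
      rewrite connect_off_sym; apply/connect1/off_notin; first exact: adjNk.
      by rewrite memc; plia.
    rewrite connect_off_sym; apply: (connect_run (y := N)) => [|u hu]; first plia.
    rewrite off_sym; apply: off_notin; first by rewrite edge_sym; apply: (adjS ham); plia.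
    by rewrite memc; plia.
  move=> v; rewrite inE -{3}(posK ham v) => /orP[/eqP->|h]; first exact: connect0.
  by apply: conn; rewrite h (pos_le ham).
have [|//|[a [b [clos av]]]] := theta_grow good; first by rewrite inE (atK ham) ?leqnn ?orbT.
  by left.
right; exists a, b; split=> // t tN /= h; apply: av => //.
by rewrite inE (atK ham) // h orbT.
Qed.

(** If [k] and [j] are consecutive, the edge between them joins two vertices of
    the cycle, but then no closed interval lies between them. *)
Lemma theta_outer : k.+1 < j -> decomposable G \/
  closed_avoiding [pred t | k <= t <= j].
Proof.
move=> kj1; pose s := down k k.+1 ++ iota j (N - j).+1; pose c := map at_ s.
have sN t : t \in s -> t <= N.
  by rewrite mem_cat mem_iota mem_down //; plia.
have memc t : t <= N -> (at_ t \in c) = (t <= k) || (j <= t).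
  move=> tN; rewrite (mem_at ham) // mem_cat mem_iota mem_down //.
  by apply/idP/idP; plia.
have [Uc cyc_c] : uniq c /\ cycle (@edge G) c.
  apply: (at_cycle ham) => //.
    rewrite cat_uniq iota_uniq uniq_down // andbT andTb; apply/hasPn => t t2.
    apply/negP => t1; move: (t1 : t \in down k _) t2.
    by rewrite mem_iota mem_down //; plia.
  rewrite /s downS /= rcons_cat cat_path path_down; last first.
    by move=> t ht; rewrite adj_sym (_ : k - t = (k - t.+1).+1); [apply: (adjS ham)|]; plia.
  rewrite last_down subnn /= adj0j rcons_path path_up; last first.
    by move=> t ht; apply: (adjS ham); plia.
  by rewrite last_up subnKC //; plia.
pose S := [set v | k <= pos N at_ v <= j].
have good : good_cycle S (at_ k) (at_ N)
    (map at_ ([seq k - i | i <- iota 1 k] ++ iota j (N - j).+1)).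
  have Dc : at_ k :: map at_ ([seq k - i | i <- iota 1 k] ++ iota j (N - j).+1) = c.
    by rewrite /c /s downS.
  rewrite /good_cycle Dc; split=> //.
  - by rewrite /c /s size_map size_cat size_iota size_map size_iota; plia.
  - by rewrite last_map last_cat /= last_up subnKC.
  move=> v; rewrite inE -{3}(posK ham v) => h; apply: connect_run h _ => u hu.
  have [E|ne] := eqVneq u k.
    rewrite off_sym; apply: off_notin; first by rewrite edge_sym; apply: (adjS ham); plia.
    by rewrite memc; plia.
  by apply: off_notin; [apply: (adjS ham)|rewrite memc]; plia.
have [|//|[a [b [clos av]]]] := theta_grow good; first by rewrite inE (atK ham) ?leqnn ?andbT //; plia.
  by left.
right; exists a, b; split=> // t tN /= h; apply: av => //.
by rewrite inE (atK ham) // h orbT.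
Qed.

(** The first two cycles give closed intervals in two of the three paths unless
    both intervals lie between [k] and [j]; the third cycle then gives one
    elsewhere. *)
Lemma theta_decomposable : decomposable G.
Proof.
have [//|[a [b [c1 av1]]]] := theta_right.
have [//|[a' [b' [c2 av2]]]] := theta_left.
have [/andP[ab bN] ja ka _] := c1; have [/andP[ab' bN'] ja' ka' _] := c2.
have ak : k < a.
  have [|h] := ltnP k a; first by [].
  by have := av1 a; rewrite /= h; plia.
have bj' : b' < j.
  have [|h] := ltnP b' j; first by [].
  by have := av2 b'; rewrite /= h orbT; plia.
have go := two_closed G3 ham j1 jN kN adj0j adjNk.
have [bk'|kb'] := leqP b' k; first by apply: (go _ _ _ _ c2 c1); plia.
have [ja1|aj] := leqP j a; first by apply: (go _ _ _ _ c2 c1); plia.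
have [|//|[a3 [b3 [c3 av3]]]] := theta_outer; first by plia.
have [/andP[ab3 bN3] ja3 ka3 _] := c3.
have [bk3|kb3] := ltnP b3 k; first by apply: (go _ _ _ _ c3 c1); plia.
have [ja3'|aj3] := ltnP j a3; first by apply: (go _ _ _ _ c1 c3); plia.
have tN : maxn a3 k <= N by plia.
have tkj : k <= maxn a3 k <= j by plia.
by have := av3 _ tN tkj; plia.
Qed.

End Theta.

(** * Disjoint end cycles *)

(** The start [d] of the monotone sequence from [d] to [v] is left out, as in
    the second argument of [path]. *)
Definition toward d v :=
  if d <= v then iota d.+1 (v - d) else [seq d - i | i <- iota 1 (d - v)].

Lemma last_toward d v : last d (toward d v) = v.
Proof.
by rewrite /toward; case: leqP => h; rewrite ?last_up ?last_down; plia.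
Qed.

Lemma mem_toward d v t : (t \in d :: toward d v) = (minn d v <= t <= maxn d v).
Proof.
rewrite /toward; case: leqP => h.
  by rewrite (mem_iota d (v - d).+1); apply/idP/idP; plia.
by rewrite -downS mem_down; [apply/idP/idP; plia|plia].
Qed.

Lemma uniq_toward d v : uniq (d :: toward d v).
Proof.
rewrite /toward; case: leqP => h; first exact: (iota_uniq d (v - d).+1).
by rewrite -downS uniq_down //; plia.
Qed.

Section Barbell.

Variables (G : sgraph) (N : nat) (at_ : nat -> G).
Hypothesis G3 : cubic G.
Hypothesis ham : ham_order N at_.
Local Notation adj := (adj_at at_).

Lemma path_toward d v : d <= N -> v <= N -> path adj d (toward d v).
Proof.
move=> dN vN; rewrite /toward; case: leqP => h.
  by apply: path_up => t ht; apply: (adjS ham); plia.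
apply: path_down => t ht; rewrite adj_sym (_ : d - t = (d - t.+1).+1); last by plia.
by apply: (adjS ham); plia.
Qed.

(** An inner vertex of the path has only one neighbour off the path. *)
Lemma cycle_path_edge (c : seq G) s : 2 < size c -> uniq c -> cycle (@edge G) c ->
  at_ s \in c -> 0 < s < N ->
  exists a, [/\ a <= s, s <= a.+1 & [set at_ a; at_ a.+1] \in cedges c].
Proof.
move=> c2 Uc cyc_c sc sN.
have en := next_cycle cyc_c sc; have ep := prev_cycle cyc_c sc.
have np := next_prev_neq c2 Uc sc.
have eS : edge (at_ s) (at_ s.+1) by apply: (adjS ham); plia.
have eP : edge (at_ s) (at_ s.-1) by apply: (adjP ham); plia.
have SP : at_ s.+1 != at_ s.-1 by apply: (at_neq ham); plia.
have before : at_ s.-1 \in [:: next c (at_ s); prev c (at_ s)] ->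
    exists a, [/\ a <= s, s <= a.+1 & [set at_ a; at_ a.+1] \in cedges c].
  move=> h; exists s.-1; rewrite prednK; last by plia.
  split; [by plia|by []|rewrite setUC].
  by move: h; rewrite !inE => /orP[] /eqP->; rewrite ?next_cedges ?prev_cedges.
have after : at_ s.+1 \in [:: next c (at_ s); prev c (at_ s)] ->
    exists a, [/\ a <= s, s <= a.+1 & [set at_ a; at_ a.+1] \in cedges c].
  move=> h; exists s; split; [by []|by plia|].
  by move: h; rewrite !inE => /orP[] /eqP->; rewrite ?next_cedges ?prev_cedges.
have [/after //|nS] := boolP (at_ s.+1 \in [:: next c (at_ s); prev c (at_ s)]).
apply: before.
rewrite edge_sym in ep; have := cubic_nbr G3 en ep eS _ eP.
have U : uniq [:: next c (at_ s); prev c (at_ s); at_ s.+1].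
  move: nS; rewrite /= !inE !negb_or np !(eq_sym (at_ s.+1)).
  by case/andP=> -> ->.
move=> /(_ U); rewrite !inE => /or3P[->|->|/eqP E]; rewrite ?orbT //.
by rewrite E eqxx in SP.
Qed.

Variables j k : nat.
Hypotheses (j1 : 1 < j) (jk : j < k) (kN : k.+1 < N).
Hypotheses (adj0j : adj 0 j) (adjNk : adj N k).
Local Notation walk := (walk N j k).

Let jN : j <= N. Proof. by plia. Qed.

Variables x' y' : nat.
Hypotheses (kx' : k < x') (y'N : y' <= N) (inn' : innermost at_ x' y').

(** An innermost chord between [x0] and [y0] and the chord [x'y'] give two
    intervals, unless an edge joins their interiors. *)
Lemma chord_or_crossing x0 y0 : x0.+1 < y0 -> y0 < j -> adj x0 y0 ->
  decomposable G \/ exists u v, [/\ x0 < u < y0, x' < v < y' & adj u v].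
Proof.
move=> xy0 y0j a0.
have [x [y [x0x yy0 inn]]] : exists x y, [/\ x0 <= x, y <= y0 & innermost at_ x y].
  by apply: (innermost_ex _ _ _ a0); plia.
have [/hasP[u]|no] := boolP (has (fun u =>
    has (fun v => [&& x0 < u < y0, x' < v < y' & adj u v]) (iota 0 N)) (iota 0 N)).
  by move=> _ /hasP[v _ /and3P[? ? ?]]; right; exists u, v.
have no_cross u v : x0 < u < y0 -> x' < v < y' -> ~~ adj u v.
  move=> hu hv; apply: contra no => uv; apply/hasP; exists u.
    by rewrite mem_iota; plia.
  by apply/hasP; exists v; [rewrite mem_iota; plia|rewrite hu hv uv].
left; have [xy axy _] := inn; have [xy' axy' _] := inn'.
apply: (two_intervals G3 ham j1 jN kN adj0j adjNk (x := x) (y := y)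
  (x' := x') (y' := y')) => //; try by plia.
  move=> z xzy.
  have [t [tN zt _ nt]] : exists t, [/\ t <= N, adj z t, ~~ walk z t & ~~ (x <= t <= y)].
    by apply: (innermost_out G3 ham j1 jN kN adj0j adjNk inn); plia.
  exists t; split=> //; apply/negP => ht.
  have hz : x0 < z < y0 by plia.
  by move: (no_cross z t hz ht); rewrite zt.
move=> z xzy.
have [t [tN zt _ nt]] : exists t, [/\ t <= N, adj z t, ~~ walk z t & ~~ (x' <= t <= y')].
  by apply: (innermost_out G3 ham j1 jN kN adj0j adjNk inn'); plia.
exists t; split=> //; apply/negP => ht.
have hz : x0 < t < y0 by plia.
by move: (no_cross t z hz xzy); rewrite adj_sym zt.
Qed.

Section Crossing.

Variables u v c d : nat.
Hypotheses (u0 : 0 < u) (uc : u < c) (cj : c < j).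
Hypotheses (xvy : x' < v < y') (xdy : x' < d < y').
Hypotheses (uv : adj u v) (cd : adj c d).

Lemma crossing_neq : v != d.
Proof.
apply/eqP => vd; have vc : adj v c by rewrite adj_sym vd.
have vu : adj v u by rewrite adj_sym.
have : c \in [:: v.-1; v.+1; u].
  apply: (adj_nbr G3 ham (s := v) _ _ vu vc).
  - by apply: (adjP ham); plia.
  - by apply: (adjS ham); plia.
  - by plia.
  - by plia.
  - by plia.
  - by plia.
  by rewrite /= !inE; plia.
by rewrite !inE; plia.
Qed.

(* The cycle follows the path from [u] to [c], crosses to [d], follows the path
   to [v] and returns to [u]. Everything off it is connected through [0j] and
   [Nk], and [S] adds its four corners to that part. *)
Let s := iota u (c - u).+1 ++ d :: toward d v.
Let S := [set x | ~~ (u < pos N at_ x < c) && ~~ (minn d v < pos N at_ x < maxn d v)].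

Lemma crossing_good : good_cycle S (at_ u) (at_ v)
  (map at_ (iota u.+1 (c - u) ++ d :: toward d v)).
Proof.
have vd := crossing_neq.
have sN t : t \in s -> t <= N by rewrite mem_cat mem_toward mem_iota; plia.
have memc t : t <= N -> (at_ t \in map at_ s) =
    (u <= t <= c) || (minn d v <= t <= maxn d v).
  move=> tN; rewrite (mem_at ham) // mem_cat mem_toward mem_iota.
  by apply/idP/idP; plia.
have [Uc cyc_c] : uniq (map at_ s) /\ cycle (@edge G) (map at_ s).
  apply: (at_cycle ham) => //.
    rewrite cat_uniq iota_uniq uniq_toward andbT andTb; apply/hasPn => t t2.
    apply/negP => t1; move: (t1 : t \in iota u _) t2.
    by rewrite mem_iota mem_toward; plia.
  rewrite /s /= rcons_cat cat_path path_up; last first.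
    by move=> t ht; apply: (adjS ham); plia.
  rewrite last_up subnKC; last by plia.
  rewrite /= [adj c d]cd rcons_path path_toward; try by plia.
  by rewrite last_toward adj_sym.
have Osym := connect_off_sym (cedges (map at_ s)).
set O := off _ in Osym.
have offl t : t < N -> t \notin s \/ t.+1 \notin s -> O (at_ t) (at_ t.+1).
  move=> tN h; have e : edge (at_ t) (at_ t.+1) by apply: (adjS ham).
  case: h => h; first by apply: off_notin; rewrite // (mem_at ham) //; plia.
  by rewrite /O off_sym; apply: off_notin; rewrite 1?edge_sym // (mem_at ham) //; plia.
have mems t : (t \in s) = (u <= t <= c) || (minn d v <= t <= maxn d v).
  by rewrite mem_cat mem_toward mem_iota; apply/idP/idP; plia.
have segA t : t <= u -> connect O (at_ 0) (at_ t).
  move=> tu; apply: (connect_run (y := u)) => [|r hr]; first by plia.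
  by apply: offl; [plia|left; rewrite mems; plia].
have segB t : c <= t <= minn d v -> connect O (at_ c) (at_ t).
  move=> ht; apply: (connect_run (y := minn d v)) => [|r hr]; first by plia.
  apply: offl; first by plia.
  by have [E|ne] := eqVneq r c; [right|left]; rewrite mems; plia.
have segC t : maxn d v <= t <= N -> connect O (at_ (maxn d v)) (at_ t).
  move=> ht; apply: (connect_run (y := N)) => [|r hr]; first by plia.
  by apply: offl; [plia|right; rewrite mems; plia].
have c0 : connect O (at_ c) (at_ 0).
  apply: connect_trans (segB j _) _; first by plia.
  rewrite Osym; apply: connect1; apply: off_notin; first exact: adj0j.
  by rewrite memc; plia.
have cM : connect O (at_ c) (at_ (maxn d v)).
  apply: connect_trans (segB k _) _; first by plia.
  rewrite Osym; apply: connect_trans (segC N _) _; first by plia.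
  apply: connect1; apply: off_notin; first exact: adjNk.
  by rewrite memc; plia.
have Ds : at_ u :: map at_ (iota u.+1 (c - u) ++ d :: toward d v) = map at_ s by [].
rewrite /good_cycle Ds; split.
- exact: Uc.
- exact: cyc_c.
- by rewrite size_map size_cat /= size_iota; plia.
- by rewrite last_map last_cat /= last_toward.
move=> x; rewrite inE -{5}(posK ham x) => hx.
have xN := pos_le ham x; move: (pos N at_ x) hx xN => t ht tN.
apply: (@connect_trans _ _ (at_ c)).
  by rewrite Osym; apply: connect_trans c0 (segA _ _).
have [tu|ut] := leqP t u; first by apply: connect_trans c0 (segA _ tu).
have [tm|mt] := leqP t (minn d v); first by apply: segB; plia.
by apply: connect_trans cM (segC _ _); plia.
Qed.

(** The rerouted cycle still passes [u] and [v], where it uses edges of the path,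
    so it breaks both cycles of the walk. A closed interval between [d] and [v]
    would contain a chord shorter than the innermost chord [x'y']. *)
Lemma crossing_decomposable : decomposable G.
Proof.
have vd := crossing_neq; have gq := crossing_good.
have inS t : t <= N -> ~~ (u < t < c) -> ~~ (minn d v < t < maxn d v) -> at_ t \in S.
  by move=> tN h1 h2; rewrite inE (atK ham) // h1 h2.
case: (grow G3 gq) => [[q' [[Uq cyc_q s2 lq _] conn]]|[X [f [g [X0 SX uX cutX]]]]].
  set c1 := at_ u :: q' in Uq cyc_q s2 conn.
  have uc1 : at_ u \in c1 by apply: mem_head.
  have vc1 : at_ v \in c1 by rewrite -lq; apply: mem_last.
  have [|a [au ua fa]] := cycle_path_edge s2 Uq cyc_q uc1; first by plia.
  have [|b [bv vb fb]] := cycle_path_edge s2 Uq cyc_q vc1; first by plia.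
  apply: (decompose_cycle G3 ham j1 jN kN adj0j adjNk s2 Uq cyc_q _
    (r := add_edge (add_edge (cut_path a b) 0 j) N k)).
  - move=> x y; apply: connect_trans (conn y).
    by rewrite connect_off_sym; apply: conn.
  - move=> p q pN qN wpq npq.
    apply: walk_cut wpq _ _ => E; subst; split; apply: contraNneq npq => ->//;
      by rewrite setUC.
  by apply: acyclic_cut2; plia.
have nX w : w \in S -> w \notin X by move=> wS; rewrite (disjointFr SX wS).
have jX : at_ j \notin X by apply/nX/inS; plia.
have kX : at_ k \notin X by apply/nX/inS; plia.
have [a [b [clos memX]]] := small_cut_closed ham j1 jN kN adj0j adjNk X0 cutX jX kX.
have av t : t <= N -> ~~ (u < t < c) -> ~~ (minn d v < t < maxn d v) -> ~~ (a <= t <= b).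
  by move=> tN h1 h2; rewrite -memX //; apply/nX/inS.
have [/andP[ab bN] _ _ closed_ab] := clos.
have [x [y [ax yb [xy axy _] out]]] :=
  chord_closed_innermost G3 ham j1 jN kN adj0j adjNk clos.
have [xy' axy' inn'1] := inn'.
have [ac|ca] := ltnP a c; last first.
  have am : minn d v < a < maxn d v.
    by apply: contraT => h; have := av a _ _ h; plia.
  have bm : b < maxn d v.
    rewrite ltnNge; apply: contraT; rewrite negbK => h.
    by have := av (maxn d v); plia.
  have [||E _] := inn'1 x y _ _ xy axy; plia.
have bc : b < c.
  rewrite ltnNge; apply: contraT; rewrite negbK => h.
  by have := av c; plia.
apply: (two_intervals G3 ham j1 jN kN adj0j adjNk (x := x) (y := y)
  (x' := x') (y' := y')) => //; try by plia.
  move=> z /out[t [tN zt nt tb]]; exists t; split=> //; plia.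
move=> z xzy.
have [t [tN zt nw nt]] : exists t, [/\ t <= N, adj z t, ~~ walk z t & ~~ (x' <= t <= y')].
  by apply: (innermost_out G3 ham j1 jN kN adj0j adjNk inn'); plia.
exists t; split=> //; apply/negP => xty.
have tz : adj t z by rewrite adj_sym.
have := closed_ab t z _ _ tz; rewrite walk_sym => /(_ _ _ nw) H.
by have : a <= z <= b by [apply: H; plia]; plia.
Qed.

End Crossing.

End Barbell.

(** * Rotating the path and conclusion *)

(** With the edge [0i] the path can run through its first [i] vertices
    backwards. *)
Definition flip i t := if t < i then i.-1 - t else t.

Lemma flip_le i t N : i <= N -> t <= N -> flip i t <= N.
Proof. by rewrite /flip; case: ltnP; plia. Qed.

Lemma flipK i t : flip i (flip i t) = t.
Proof.
rewrite {2}/flip; case: ltnP => h; rewrite /flip; last by rewrite ltnNge h.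
by rewrite ifT; plia.
Qed.

Section Rotation.

Variables (G : sgraph) (N : nat) (at_ : nat -> G) (i : nat).
Hypotheses (ham : ham_order N at_) (i0 : 0 < i) (iN : i <= N).
Hypothesis adj0i : adj_at at_ 0 i.

Lemma rotated_order : ham_order N (at_ \o flip i).
Proof.
split=> [v|s t sN tN /= E|t tN].
- exists (flip i (pos N at_ v)); first by apply: (flip_le iN); apply: (pos_le ham).
  by rewrite /= flipK (posK ham).
- by rewrite -(flipK i s) -(flipK i t) (at_inj ham _ _ E) // (flip_le iN).
rewrite /= /flip; have [ti|it] := ltnP t.+1 i.
  rewrite ifT; last by plia.
  rewrite edge_sym (_ : i.-1 - t = (i.-1 - t.+1).+1); last by plia.
  by apply: (adjS ham); plia.
have [ti|it'] := ltnP t i; last by apply: (adjS ham).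
have E1 : i.-1 - t = 0 by plia.
have E2 : t.+1 = i by plia.
by rewrite E1 E2; apply: adj0i.
Qed.

End Rotation.

Lemma adj_second (G : sgraph) N (at_ : nat -> G) s a : cubic G ->
  ham_order N at_ -> adj_at at_ s a -> a <= N ->
  exists b, [/\ b <= N, adj_at at_ s b & b != a].
Proof.
move=> G3 ham sa aN.
have /set0Pn[d] : [set y | edge (at_ s) y] :\ at_ a != set0.
  rewrite -card_gt0; have := cardsD1 (at_ a) [set y | edge (at_ s) y].
  by rewrite G3 inE; case: (edge _ _) => /= H; plia.
rewrite !inE => /andP[da sd]; exists (pos N at_ d).
rewrite (pos_le ham) /adj_at /= (posK ham); split=> //.
by apply: contraNneq da => <-; rewrite (posK ham).
Qed.

(** The third neighbour of the vertex before [i] becomes the far neighbour of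
    the first vertex when the path is rotated, so [(i, j)] may be assumed
    lexicographically smallest. *)
Lemma ham_order_decomposable (G : sgraph) N (at_ : nat -> G) i j : cubic G ->
  ham_order N at_ -> adj_at at_ 0 i -> adj_at at_ 0 j -> 1 < i -> i < j -> j <= N ->
  decomposable G.
Proof.
(* As [j <= N], the order of these numbers is the lexicographic one. *)
move=> G3; have [m] := ubnP (i * N.+1 + j).
elim: m at_ i j => // m IH at_ i j ltm ham a0i a0j i1 ij jN.
have a01 : adj_at at_ 0 1 by apply: (adjS ham); plia.
have N1 : 1 < N by plia.
have [E|jN'] := eqVneq j N.
  by apply: (hamiltonian_decomposable G3 ham N1); rewrite -E.
have aNP : adj_at at_ N N.-1 by apply: (adjP ham); plia.
have nbr0 t : t <= N -> adj_at at_ 0 t -> [\/ t = 1, t = i | t = j].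
  move=> tN a0t.
  have : t \in [:: 1; i; j].
    by apply: (adj_nbr G3 ham a01 a0i a0j a0t) => //; rewrite /= ?inE; plia.
  by rewrite !inE => /or3P[] /eqP->; constructor.
have inner s x y : 0 < s < N -> x <= N -> y <= N -> adj_at at_ s x -> adj_at at_ s y ->
    x.+1 < s \/ s.+1 < x -> y.+1 < s \/ s.+1 < y -> x = y.
  move=> sN xN yN sx sy hx hy.
  have : y \in [:: s.-1; s.+1; x].
    apply: (adj_nbr G3 ham (s := s) _ _ sx sy) => //.
    - by apply: (adjP ham); plia.
    - by apply: (adjS ham); plia.
    - by plia.
    - by plia.
    by rewrite /= !inE; plia.
  by rewrite !inE; plia.
have [k0 [k0N aNk0 k0P]] : exists b, [/\ b <= N, adj_at at_ N b & b != N.-1].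
  by apply: (adj_second G3 ham aNP); plia.
have [l0 [l0N aNl0 l0P l0k0]] : exists t, [/\ t <= N, adj_at at_ N t, t != N.-1 & t != k0].
  by apply: (adj_third G3 ham aNP aNk0); plia.
have nN t : adj_at at_ N t -> t != N by apply: contraTneq => ->; rewrite adj_irr.
have n0 t : adj_at at_ N t -> t <= N -> t <> 0.
  move=> aNt tN t0; rewrite t0 adj_sym in aNt.
  by case: (nbr0 N _ aNt); plia.
have [k [l [kl lN aNk aNl]]] : exists k l, [/\ k < l, l.+1 < N, adj_at at_ N k & adj_at at_ N l].
  have := nN _ aNk0; have := nN _ aNl0.
  case: (ltngtP k0 l0) => h hk hl; last by plia.
    by exists k0, l0; split=> //; plia.
  by exists l0, k0; split=> //; plia.
have k_0 : 0 < k by have := n0 _ aNk; plia.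
have [kj|jk|E] := ltngtP k j; last first.
- have aj0 : adj_at at_ j 0 by rewrite adj_sym.
  have ajN : adj_at at_ j N by rewrite -E adj_sym.
  by have : 0 = N by [apply: (inner j _ _ _ _ _ aj0 ajN); plia]; plia.
- have [w [wN aw w2 wi]] : exists t, [/\ t <= N, adj_at at_ i.-1 t, t != i.-2 & t != i].
    apply: (adj_third G3 ham); try by plia.
      by apply: (adjP ham); plia.
    by rewrite -{2}(prednK (ltnW i1)); apply: (adjS ham); plia.
  have wi1 : w != i.-1 by apply: contraTneq aw => ->; rewrite adj_irr.
  pose at' := at_ \o flip i.
  have ham' : ham_order N at' by apply: (rotated_order ham) a0i; plia.
  have f0 : flip i 0 = i.-1 by rewrite /flip ifT ?subn0 //; plia.
  have fi t : i <= t -> flip i t = t by move=> it; rewrite /flip ltnNge it.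
  have fw : flip i (flip i w) = w by apply: flipK.
  have a'i : adj_at at' 0 i.
    rewrite /at' /adj_at /= f0 fi // -{2}(prednK (ltnW i1)).
    by apply: (adjS ham); plia.
  have a'w : adj_at at' 0 (flip i w) by rewrite /at' /adj_at /= f0 fw.
  have [wlti|iw] := ltnP w i.
    have fwE : flip i w = i.-1 - w by rewrite /flip wlti.
    have ltm' : (i.-1 - w) * N.+1 + i < m.
      have : (i.-1 - w).+1 * N.+1 <= i * N.+1 by rewrite leq_mul2r; plia.
      by move: (i.-1 - w) (i * N.+1) ltm => K L; rewrite mulSn; plia.
    rewrite fwE in a'w.
    by apply: (IH at' (i.-1 - w) i ltm' ham' a'w a'i); plia.
  have {}iw : i < w by plia.
  rewrite fi in a'w; last by plia.
  have [wj|jw|E] := ltngtP w j; last first.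
  + have aj0 : adj_at at_ j 0 by rewrite adj_sym.
    have aji : adj_at at_ j i.-1 by rewrite -E adj_sym.
    by have : 0 = i.-1 by [apply: (inner j _ _ _ _ _ aj0 aji); plia]; plia.
  + have [E|wN'] := eqVneq w N.
      by apply: (hamiltonian_decomposable G3 ham' N1); rewrite -E.
    have aNk' : adj_at at' N k by rewrite /at' /adj_at /= !fi //; plia.
    have [kw|wk|E] := ltngtP k w; last first.
    * have aki : adj_at at_ k i.-1 by rewrite E adj_sym.
      have akN : adj_at at_ k N by rewrite adj_sym.
      by have : i.-1 = N by [apply: (inner k _ _ _ _ _ aki akN); plia]; plia.
    * have [x' [y' [lx' y'N inn']]] : exists x y, [/\ l <= x, y <= N & innermost at_ x y].
        by apply: (innermost_ex (s := l) (t := N)); rewrite 1?adj_sym //; plia.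
      have kx' : k < x' by plia.
      have inn'' : innermost at' x' y'.
        have [xy' axy' H] := inn'; split=> //.
          by rewrite /at' /adj_at /= !fi //; plia.
        by move=> s t xs ty st; rewrite /at' /adj_at /= !fi; [apply: H|plia|plia].
      have j1 : 1 < j by plia.
      have w1 : 1 < w by plia.
      have kN : k.+1 < N by plia.
      have [//|[u [v [u_i vxy uv]]]] :=
        chord_or_crossing G3 ham j1 jk kN a0j aNk kx' y'N inn' i1 ij a0i.
      have a'j : adj_at at' i.-1 j.
        rewrite /at' /adj_at /= (fi j); last by plia.
        by rewrite /flip ifT ?subnn; [exact: a0j|plia].
      have ij1 : i.-1.+1 < j by plia.
      have [//|[c [d [c_j dxy cd]]]] :=
        chord_or_crossing G3 ham' w1 wk kN a'w aNk' kx' y'N inn'' ij1 jw a'j.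
      have cd' : adj_at at_ c d by move: cd; rewrite /at' /adj_at /= !fi //; plia.
      apply: (crossing_decomposable G3 ham j1 jk kN a0j aNk kx' y'N inn'
        (u := u) (v := v) (c := c) (d := d)) => //; plia.
    by apply: (theta_decomposable G3 ham' _ kw _ a'w aNk'); plia.
  apply: (IH at' i w) => //; plia.
by apply: (theta_decomposable G3 ham k_0 kj _ a0j aNk); plia.
Qed.

Theorem theorem2 (G : sgraph) (hG3 : cubic G) (hGt : traceable G) :
  exists (F M : {set {set G}}) (CC : {set {set {set G}}}),
    [/\ is_spanning_tree G F, is_matching G M
      & forall C : {set {set G}}, C \in CC -> is_cycle G C] /\
    [/\ edges G = F :|: M :|: cover CC,
        [disjoint F & M], [disjoint F & cover CC], [disjoint M & cover CC]
      & trivIset CC].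
Proof.
have [x [p [pth U cov]]] := hGt.
pose at_ t := nth x (x :: p) t.
have ham : ham_order (size p) at_.
  split=> [v|s t sp tp|t tp].
  - exists (index v (x :: p)); last exact: nth_index.
    by have := cov v; rewrite -index_mem.
  - by move/eqP; rewrite nth_uniq // => /eqP.
  exact: (pathP x pth).
have p0 : 0 < size p.
  case: p {pth U at_ ham} cov => // cov; have := hG3 x.
  have -> : [set y | edge x y] = set0.
    by apply/setP=> y; move: (cov y); rewrite !inE => /eqP->; rewrite edge_irr.
  by rewrite cards0.
have a01 : adj_at at_ 0 1 by apply: (adjS ham).
have [b [bN a0b b1]] := adj_second hG3 ham a01 p0.
have b1' : 1 != b by rewrite eq_sym.
have [d [dN a0d d1 db]] := adj_third hG3 ham a01 a0b p0 bN b1'.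
have nz t : adj_at at_ 0 t -> t != 0 by apply: contraTneq => ->; rewrite adj_irr.
have {}b1 : 1 < b by have := nz b a0b; plia.
have {}d1 : 1 < d by have := nz d a0d; plia.
case: (ltngtP b d) => bd; last by rewrite bd eqxx in db.
  exact: (ham_order_decomposable hG3 ham a0b a0d b1 bd dN).
exact: (ham_order_decomposable hG3 ham a0d a0b d1 bd bN).
Qed.
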